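(* Let $K>0$. Suppose that $P$ is a probability measure supported on a compact $d'$-dimensional $\mathcal{C}^2$-submanifold $N$ of $B(0,K)\subset\mathbb{R}^d$. Assume that $N$ has positive reach $\rho$, and that $P$ has a density $f$ with $0<f_{min}\le f\le f_{max}$ with respect to the volume measure on $N$. Moreover, suppose that $P$ satisfies, for a constant $c>0$, for all $x\in N$ and $r>0$, $$P(B(x,r))\ge cf_{min}r^{d'}\wedge1.$$ Then there are positive constants $c_{N,f_{min}}$, $c'_{N,f_{min}}$ and $C_{N,f_{min},f_{max}}$ such that, for $k\ge c_{N,f_{min}}$ and $0<h\le c'_{N,f_{min}}$, for any $k$-PDTM $\mathrm{d}_{P,h,k}$ of $P$, $$0\le\int\left(\mathrm{d}^2_{P,h,k}(u)-\mathrm{d}^2_{P,h}(u)\right)dP(u)\le C_{N,f_{min},f_{max}}k^{-2/d'}.$$ Here $c_{N,f_{min}},c'_{N,f_{min}}$ depend only on $N$ (and $c$) and $f_{min}$, and $C_{N,f_{min},f_{max}}$ only on $N$ (and $c$), $f_{min}$ and $f_{max}$.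
   Context: The submanifold $N$ may have a boundary. $\mathbb{R}^d$ carries the Euclidean norm; $B(x,r)$ and $\overline{B}(x,r)$ are the open and closed balls. For a unit vector $v$ and $c\in\mathbb{R}$, $H(v,c)=\{x:\langle x,v\rangle>c\}$. Conventions: $\inf\emptyset=+\infty$, $\sup\emptyset=-\infty$, $B(x,+\infty)=H(v,-\infty)=\mathbb{R}^d$. $\delta_{P,l}(x)=\inf\{r>0: P(\overline{B}(x,r))>l\}$; $c_{P,h}(v)=\sup\{c\in\mathbb{R}: P(H(v,c))>h\}$; the distance to measure (DTM) is $\mathrm{d}_{P,h}(x)\ge0$ with $\mathrm{d}^2_{P,h}(x)=\frac1h\int_0^h\delta_{P,l}^2(x)\,dl$. Let $\overline{\mathbb{R}}_d=\mathbb{R}^d\cup\{v_\infty: \|v\|=1\}$, where $v_\infty$ is a point at infinity in direction $v$. For $x\in\mathbb{R}^d$, $\mathcal{P}_{x,h}(P)$ is the set of probability measures $P_{x,h}=\frac1h Q$ with $Q$ a sub-measure of $P$ of total mass $h$, coinciding with $P$ on $B(x,\delta_{P,h}(x))$ and supported on $\overline{B}(x,\delta_{P,h}(x))$. For $x=v_\infty$, $\mathcal{P}_{v_\infty,h}(P)$ is defined in the same way with $H(v,c_{P,h}(v))$ and its closure replacing the open and closed ball. $P_{x,h}$ denotes an element of $\mathcal{P}_{x,h}(P)$; $m(P_{x,h})=\int u\,dP_{x,h}(u)$, $v(P_{x,h})=\int\|u-m(P_{x,h})\|^2dP_{x,h}(u)$. For a set $A$, $A^{(k)}$ is the set of $k$-tuples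 of elements of $A$ up to permutation. $\mathcal{O}pt(P,h,k)$ is the set of $t\in\overline{\mathbb{R}}_d^{(k)}$ minimizing $\int\min_{i}(\|u-m(P_{t_i,h})\|^2+v(P_{t_i,h}))\,dP(u)$ (over $t$ and over the choices of $P_{t_i,h}\in\mathcal{P}_{t_i,h}(P)$ when not unique). A $k$-PDTM of $P$ is a nonnegative function $\mathrm{d}_{P,h,k}$ given, for some minimizer $s\in\mathcal{O}pt(P,h,k)$ (with its minimizing choice of $P_{s_i,h}$), by $\mathrm{d}^2_{P,h,k}(x)=\min_{i}\|x-m(P_{s_i,h})\|^2+v(P_{s_i,h})$. *)

(* Defs.v *)
From HB Require Import structures.
From mathcomp Require Import all_boot all_order all_algebra.
From mathcomp Require Import all_classical all_reals all_analysis.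
From mathcomp Require Import measurable_realfun.

Set Implicit Arguments.
Unset Strict Implicit.
Unset Printing Implicit Defensive.

Import Order.TTheory GRing.Theory Num.Theory.
Import numFieldNormedType.Exports.

Local Open Scope classical_set_scope.
Local Open Scope ring_scope.

(* R^n with its Borel sigma-algebra. The library norm on ['rV[R]_n] is the sup
   norm: it is used only through the topology and the differential calculus it
   induces, the Euclidean norm being [enorm] below. *)
Notation eucl R n := (g_sigma_algebraType (@open 'rV[R]_n)).

Section LebesgueMeasure.
Variable R : realType.

Lemma measurable_coord n (i : 'I_n) :
  measurable_fun [set: eucl R n] (fun x : eucl R n => (x : 'rV[R]_n) 0 i).
Proof.
apply: (measurability _ (RGenOpens.measurableE R)) => _ [_ [a [b ->]] <-].
rewrite setTI; apply: sub_sigma_algebra.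
apply: (@open_comp _ _ (fun x : 'rV[R]_n => x 0 i)); last exact: interval_open.
by move=> x _; exact: coord_continuous.
Qed.

Lemma rat_row_ball n (x : 'rV[R]_n) (e : R) : 0 < e ->
  exists z : 'rV[rat]_n, ball x e (map_mx ratr z : 'rV[R]_n).
Proof.
move=> e0.
have h i : exists q : rat, ball (x 0 i) e (ratr q : R).
  have xe : x 0 i < x 0 i + e by rewrite ltrDl.
  have [q] := rat_in_itvoo xe.
  rewrite in_itv/= => /andP[q1 q2]; exists q.
  by rewrite /ball/= distrC gtr0_norm ?subr_gt0// ltrBlDl.
have [f fP] := choice h.
exists (\row_i f i); split => // i j.
by rewrite !mxE ord1; exact: fP.
Qed.

Lemma measurable_eucl d (T : measurableType d) n (f : T -> eucl R n) :
  (forall i, measurable_fun setT (fun t => (f t : 'rV[R]_n) 0 i)) ->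
  measurable_fun setT f.
Proof.
move=> mf; apply: (@measurability _ _ T (eucl R n) setT f (@open (matrix R 1 n))) => // _ [U oU <-].
rewrite setTI.
pose B (zk : 'rV[rat]_n * nat) : set 'rV[R]_n :=
  ball (map_mx ratr zk.1 : 'rV[R]_n) zk.2.+1%:R^-1.
have -> : f @^-1` U =
  \bigcup_zk (if `[< B zk `<=` U >] then f @^-1` (B zk) else set0).
  apply/seteqP; split => [t Uft|t [zk _]]; last by case: asboolP => // h /h.
  have : nbhs (f t : 'rV[R]_n) U by exact: open_nbhs_nbhs.
  move=> /nbhs_ballP[e /= e0 eU].
  have [k ke] : exists k : nat, k.+1%:R^-1 < e / 2.
    near \oo => k; exists k.
    by near: k; apply: near_infty_natSinv_lt (PosNum (divr_gt0 e0 _)).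
  have [z zP] := rat_row_ball (f t : 'rV[R]_n) (ltac:(by []) : 0 < k.+1%:R^-1 :> R).
  exists (z, k) => //; case: asboolP => [_|]; first exact: ball_sym.
  case => y By; apply: eU; rewrite [e]splitr.
  apply: (@ball_triangle R ('rV[R]_n) (map_mx ratr z) (f t) y).
    by apply: le_ball zP; exact: ltW.
  by apply: le_ball By; exact: ltW.
apply: countable_bigcupT_measurable; first exact: countableP.
move=> zk; case: asboolP => // _.
have -> : f @^-1` B zk = \bigcap_(i in [set: 'I_n])
   ((fun t => (f t : 'rV[R]_n) 0 i) @^-1` ball (ratr (zk.1 0 i) : R) zk.2.+1%:R^-1).
  apply/seteqP; split => t.
    by move=> [_ Bt] i _; have := Bt 0 i; rewrite mxE.
  by move=> Bt; split => // i j; rewrite ord1 mxE; exact: Bt.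
apply: fin_bigcap_measurable => // i _.
rewrite -[X in measurable X]setTI; apply: mf => //.
exact: measurable_ball.
Unshelve. all: by end_near.
Qed.

Definition cons_row n (p : R * eucl R n) : eucl R n.+1 :=
  (row_mx p.1%:M (p.2 : 'rV[R]_n) : 'rV[R]_(1 + n)).

Definition uncons_row n (y : eucl R n.+1) : R * eucl R n :=
  ((y : 'rV[R]_n.+1) 0 0, rsubmx (y : 'rV[R]_(1 + n))).

Lemma cons_rowK n : cancel (@cons_row n) (@uncons_row n).
Proof.
move=> [a x]; rewrite /uncons_row /cons_row /= row_mxKr; congr pair.
have -> : (0 : 'I_n.+1) = lshift n (0 : 'I_1) by exact/val_inj.
by apply: (etrans (row_mxEl (a%:M : 'M[R]_1) (x : 'rV[R]_n) 0 0)); rewrite mxE eqxx.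
Qed.

Lemma measurable_cons_row n : measurable_fun setT (@cons_row n).
Proof.
apply: measurable_eucl => i.
have [j ->|j ->] := @split_ordP 1 n i.
  rewrite (_ : (fun t => _) = fst) //; apply/funext => t.
  apply: (etrans (row_mxEl (t.1%:M : 'M[R]_1) (t.2 : 'rV[R]_n) 0 j)).
  by rewrite mxE !ord1 eqxx.
rewrite (_ : (fun t => _) = (fun x : eucl R n => (x : 'rV[R]_n) 0 j) \o snd).
  by apply: measurableT_comp => //; exact: measurable_coord.
by apply/funext => t; exact: (row_mxEr (t.1%:M : 'M[R]_1) (t.2 : 'rV[R]_n) 0 j).
Qed.

Lemma measurable_uncons_row n : measurable_fun setT (@uncons_row n).
Proof.
apply: measurable_fun_pair; first exact: measurable_coord.
apply: measurable_eucl => i.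
rewrite (_ : (fun t => _) = fun x : eucl R n.+1 => (x : 'rV[R]_n.+1) 0 (rshift 1 i)).
  exact: measurable_coord.
by apply/funext => t; rewrite mxE.
Qed.

Section Step.
Variables (n : nat) (m : {sigma_finite_measure set (eucl R n) -> \bar R}).

Definition lebesgue_step (A : set (eucl R n.+1)) : \bar R :=
  pushforward (@lebesgue_measure R \x m)%E (@cons_row n) A.

Let s0 : lebesgue_step set0 = 0%E.
Proof. by rewrite /lebesgue_step /pushforward preimage_set0 measure0. Qed.

Let s_ge0 A : (0 <= lebesgue_step A)%E.
Proof. by rewrite /lebesgue_step /pushforward measure_ge0. Qed.

Let s_add : semi_sigma_additive lebesgue_step.
Proof.
move=> F mF tF mUF; rewrite /lebesgue_step /pushforward preimage_bigcup.
have mp k : measurable (@cons_row n @^-1` F k).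
  by rewrite -[X in measurable X]setTI; exact: measurable_cons_row.
apply: measure_semi_sigma_additive => //.
- apply/trivIsetP => /= i j _ _ ij; rewrite -preimage_setI.
  by move/trivIsetP : tF => /(_ _ _ _ _ ij) ->//; rewrite preimage_set0.
- by apply: bigcupT_measurable.
Qed.

HB.instance Definition _ := isMeasure.Build _ _ _ lebesgue_step s0 s_ge0 s_add.

Let s_sfin : sigma_finite setT lebesgue_step.
Proof.
have /sigma_finiteP[F [TF ndF Foo]] := sigma_finiteT (@lebesgue_measure R).
have /sigma_finiteP[G [TG ndG Goo]] := sigma_finiteT m.
exists (fun k => @uncons_row n @^-1` (F k `*` G k)).
  rewrite -preimage_bigcup; apply/esym/seteqP; split => // y _.
  have [i _ Fi] : (\bigcup_k F k) (uncons_row y).1 by rewrite -TF.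
  have [j _ Gj] : (\bigcup_k G k) (uncons_row y).2 by rewrite -TG.
  exists (maxn i j) => //; split.
  - by move: (_.1) Fi; exact/subsetPset/ndF/leq_maxl.
  - by move: (_.2) Gj; exact/subsetPset/ndG/leq_maxr.
move=> k; have [mF Fk] := Foo k; have [mG Gk] := Goo k; split.
  rewrite -[X in measurable X]setTI; apply: measurable_uncons_row => //.
  exact: measurableX.
rewrite /lebesgue_step /pushforward -comp_preimage.
rewrite (_ : _ \o _ = id); last by apply/funext; exact: cons_rowK.
by rewrite preimage_id product_measure1E// lte_mul_pinfty// ge0_fin_numE.
Qed.

HB.instance Definition _ := @Measure_isSigmaFinite.Build _ _ _ lebesgue_step s_sfin.
End Step.

(* n-dimensional Lebesgue measure, via R^(n+1) = R x R^n. *)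
Fixpoint lebesgue_eucl n : {sigma_finite_measure set (eucl R n) -> \bar R} :=
  if n is k.+1 then lebesgue_step (lebesgue_eucl k)
  else dirac ((0 : 'rV[R]_0) : eucl R 0).

End LebesgueMeasure.

Section EuclideanGeometry.
Variables (R : realType) (d : nat).
Implicit Types (x y v : 'rV[R]_d) (N : set 'rV[R]_d).

Definition dotp x y : R := \sum_(i < d) x 0 i * y 0 i.

Definition enorm x : R := Num.sqrt (\sum_(i < d) x 0 i ^+ 2).

(* Radii and offsets are extended reals, so that the ball of radius +oo and the
   half-space of offset -oo are the whole space. *)
Definition eball x (r : \bar R) : set 'rV[R]_d :=
  [set y | ((enorm (y - x))%:E < r)%E].

Definition ecball x (r : \bar R) : set 'rV[R]_d :=
  [set y | ((enorm (y - x))%:E <= r)%E].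

Definition halfspace v (c : \bar R) : set 'rV[R]_d :=
  [set y | (c < (dotp y v)%:E)%E].

Definition dist_to N x : \bar R :=
  ereal_inf [set (enorm (x - y))%:E | y in N].

Definition nearest N x y := N y /\ (enorm (x - y))%:E = dist_to N x.

(* Federer's reach; it is +oo when N is closed and convex. *)
Definition reach N : \bar R :=
  ereal_sup [set r : \bar R |
    forall x, (dist_to N x < r)%E -> exists! y, nearest N x y].

End EuclideanGeometry.

Section Submanifold.
Variable R : realType.

Definition C1_on n m (V : set 'rV[R]_n) (g : 'rV[R]_n -> 'rV[R]_m) :=
  forall y, V y -> differentiable g y /\ {for y, continuous (fun z => 'J g z)}.

Definition C2_on n m (V : set 'rV[R]_n) (g : 'rV[R]_n -> 'rV[R]_m) :=
  C1_on V g /\ C1_on V (fun y => mxvec ('J g y)).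

(* The part of V in the half-space R_+ x R^(n-1). *)
Definition half_part n (V : set 'rV[R]_n) : set 'rV[R]_n :=
  [set y | V y /\ forall i : 'I_n, nat_of_ord i = 0%N -> 0 <= y 0 i].

(* A C^2 immersion psi on an open subset V of R^d', restricting to a
   homeomorphism from [half_part V] onto a relatively open subset of N. If V lies
   in the open half-space, it parametrizes N near interior points; otherwise psi
   maps the points of V with y_0 = 0 into the boundary of N. Jacobian matrices
   multiply row vectors on the right, so ['J psi y] is a d' x d matrix. *)
Definition local_param d d' (N : set 'rV[R]_d) (V : set 'rV[R]_d')
    (psi : 'rV[R]_d' -> 'rV[R]_d) :=
  [/\ open V,
      C2_on V psi,
      forall y, V y -> row_free ('J psi y),
      {in half_part V &, injective psi} &
      forall W, open W -> W `<=` V ->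
        exists2 U, open U & psi @` half_part W = N `&` U].

(* d'-dimensional embedded C^2-submanifold of R^d, possibly with boundary. *)
Definition C2_submanifold d d' (N : set 'rV[R]_d) :=
  forall x, N x -> exists V (psi : 'rV[R]_d' -> 'rV[R]_d),
    local_param N V psi /\ (psi @` (half_part V)) x.

(* The Riemannian volume measure of N for the metric induced by R^d, as a
   measure on R^d carried by N. *)
Definition is_volume_measure d d' (N : set 'rV[R]_d)
    (vol : {measure set (eucl R d) -> \bar R}) :=
  vol (~` N) = 0%E /\
  forall V (psi : 'rV[R]_d' -> 'rV[R]_d), local_param N V psi ->
  forall A : set (eucl R d'), measurable A ->
    A `<=` half_part V ->
    vol (psi @` A) =
    (\int[lebesgue_eucl R d']_(y in A)
       (Num.sqrt (\det ('J psi y *m ('J psi y)^T)))%:E)%E.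

Definition has_density d d' (N : set 'rV[R]_d)
    (P : set (eucl R d) -> \bar R) (f : 'rV[R]_d -> R) :=
  measurable_fun (N : set (eucl R d)) (f : eucl R d -> R) /\
  exists2 vol : {measure set (eucl R d) -> \bar R},
    is_volume_measure d' N vol &
    forall A : set (eucl R d), measurable A ->
      P A = (\int[vol]_(y in A `&` N) (f y)%:E)%E.

End Submanifold.

Section DistanceToMeasure.
Variables (R : realType) (d : nat).
Implicit Types (P mu : probability (eucl R d) R) (h l : R) (x v : 'rV[R]_d).

Definition delta P l x : \bar R :=
  ereal_inf [set r%:E | r in [set r : R | 0 < r /\ (l%:E < P (ecball x r%:E))%E]].

Definition offset P h v : \bar R :=
  ereal_sup [set c%:E | c in [set c : R | (h%:E < P (halfspace v c%:E))%E]].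

Definition dtm P h x : \bar R :=
  sqrte ((h^-1)%:E * \int[lebesgue_measure]_(l in `[0%R, h]) (delta P l x ^+ 2))%E.

(* R^d together with the points at infinity v_infty in direction v. *)
Inductive ext_point :=
  | FinitePoint of 'rV[R]_d
  | InfinitePoint v of enorm v = 1.

Definition inner_region P h (t : ext_point) : set 'rV[R]_d :=
  match t with
  | FinitePoint x => eball x (delta P h x)
  | InfinitePoint v _ => halfspace v (offset P h v)
  end.

Definition outer_region P h (t : ext_point) : set 'rV[R]_d :=
  match t with
  | FinitePoint x => ecball x (delta P h x)
  | InfinitePoint v _ => closure (halfspace v (offset P h v))
  end.

Definition local_measure P h (t : ext_point) mu :=
  exists Q : {measure set (eucl R d) -> \bar R},
  [/\ forall A : set (eucl R d), measurable A -> (Q A <= P A)%E,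
      Q setT = h%:E,
      forall A : set (eucl R d), measurable A -> A `<=` inner_region P h t -> Q A = P A,
      Q (~` outer_region P h t) = 0%E &
      forall A : set (eucl R d), measurable A -> mu A = ((h^-1)%:E * Q A)%E].

Definition mean mu : 'rV[R]_d :=
  \row_i Rintegral mu setT (fun u : eucl R d => (u : 'rV[R]_d) 0 i).

Definition mean_sq_dev mu : R :=
  Rintegral mu setT (fun u : eucl R d => enorm ((u : 'rV[R]_d) - mean mu) ^+ 2).

Definition min_power k (mu : 'I_k -> probability (eucl R d) R) x : \bar R :=
  \big[mine/+oo%E]_(i < k) (enorm (x - mean (mu i)) ^+ 2 + mean_sq_dev (mu i))%:E.

Definition criterion P k (mu : 'I_k -> probability (eucl R d) R) : \bar R :=
  (\int[P]_u min_power mu u)%E.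

(* t is in Opt(P,h,k), with minimizing choice mu of the local measures. The
   criterion is invariant under permutations of the indices, so k-tuples up to
   permutation are represented by indexed families. *)
Definition optimal P h k (t : 'I_k -> ext_point)
    (mu : 'I_k -> probability (eucl R d) R) :=
  (forall i, local_measure P h (t i) (mu i)) /\
  forall (t' : 'I_k -> ext_point) (mu' : 'I_k -> probability (eucl R d) R),
    (forall i, local_measure P h (t' i) (mu' i)) ->
    (criterion P mu <= criterion P mu')%E.

Definition is_kPDTM P h k (dk : 'rV[R]_d -> R) :=
  (forall x, 0 <= dk x) /\
  exists (s : 'I_k -> ext_point) (mu : 'I_k -> probability (eucl R d) R),
    optimal P h s mu /\ forall x, (dk x ^+ 2)%:E = min_power mu x.

End DistanceToMeasure.

(* Main.v *)
(* By the bias-variance identity, |x - m(mu)|^2 + v(mu) is the second moment about x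
   of mu.  It dominates d_{P,h}(x)^2 whenever h mu <= P, with equality for
   mu in P_{x,h}; hence the lower bound.
   For the upper bound, compare the optimum with k-tuples of centres t_i in N:
   the second moment of P_{t,h} about u exceeds d_{P,h}(u)^2 by at most
   2 <t - u, m(P_{t,h}) - m(P_{u,h})>.  With r = delta_{P,h}(t) and e = |u - t|, the
   two measures agree off the annulus {r - 2e <= |w - t| <= r + 2e}, whose mass is
   at most a constant times r^(d'-1) e, while r^d' is at most a constant times h;
   so the excess is at most a constant times e^2, uniformly in h.  A maximal
   eps-separated subset of N has at most k points when eps is of order k^(-1/d').
   In a chart, the annulus estimate holds because the homothetic images of the
   annulus with ratios 1 + j tau are disjoint as soon as tau exceeds a multiple of
   its relative width. *)

(* The annulus estimate must be linear in the width and hold around every point of N, boundary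
   points included, where spheres may meet N in an uncontrolled way. The packing argument asks
   nothing of the shape of the parameter annulus: its homothetic copies live in R^d' and may leave
   the half-space or the chart, since only their disjointness, their Lebesgue measure and an
   enclosing ball matter. The radius and the constant of a chart are fixed before the volume
   measure, P and h appear; compactness of N then gives one pair for all points, so that the final
   constants depend on N, c, fmin and fmax only. Optimality controls the integral of the criterion,
   not the k-PDTM pointwise, so the comparison with a net is made between integrals. Splitting these
   requires d_{P,h}^2 to be measurable, which is obtained from its continuity. *)
From HB Require Import structures.
Require Import Defs.
From mathcomp Require Import all_boot all_order all_algebra.
From mathcomp Require Import all_classical all_reals all_analysis.
From mathcomp Require Import measurable_realfun perm ring lra.

Set Implicit Arguments.
Unset Strict Implicit.
Unset Printing Implicit Defensive.

Import Order.TTheory GRing.Theory Num.Theory.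
Import numFieldNormedType.Exports.

Local Open Scope classical_set_scope.
Local Open Scope ring_scope.

(** * Scaling of Lebesgue measure *)

Section LebesgueScaling.
Variable R : realType.
Implicit Types l v : R.

Definition affine1 l v (x : measurableTypeR R) : measurableTypeR R := l * x + v.

Lemma measurable_affine1 l v : measurable_fun setT (affine1 l v).
Proof.
apply: (measurable_funD (f := fun x => l * x) (g := cst v)) => //.
exact: measurable_funM.
Qed.

(** Uniqueness of Lebesgue measure: [l] times its image under the affine map gives every interval
    ]a, b] its length. *)
Lemma lebesgue_measure_affine l v (A : set (measurableTypeR R)) : 0 < l ->
  measurable A ->
  (@lebesgue_measure R (affine1 l v @^-1` A) = l^-1%:E * lebesgue_measure A)%E.
Proof.
move=> l0 mA.
have mf := measurable_affine1 l v.
pose m := mscale (NngNum (ltW l0)) (pushforward (@lebesgue_measure R) (affine1 l v))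
  : {measure set (measurableTypeR R) -> \bar R}.
have E X : measurable X -> lebesgue_measure X = m mf X.
  apply: lebesgue_measure_unique => X' [[a b] /= _ <-] /=.
  rewrite /m /mscale /= /pushforward /=.
  have -> : affine1 l v @^-1` `]a, b]%classic = `](a - v) / l, (b - v) / l]%classic.
    apply/seteqP; split => x /=; rewrite !in_itv/= /affine1 ltr_pdivrMr// ler_pdivlMr//
      ltrBlDr lerBrDr (mulrC l); done.
  rewrite !lebesgue_measure_itv/= !lte_fin ltr_pM2r ?invr_gt0// ltrD2r.
  case: ifPn => _; last by rewrite mule0.
  by rewrite -!EFinB -EFinM; congr EFin; field; exact: lt0r_neq0.
rewrite (E _ mA) /m /mscale /= /pushforward /= muleA -EFinM mulVf ?gt_eqF// mul1e.
done.
Qed.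

Definition affine n l (v : 'rV[R]_n) (x : eucl R n) : eucl R n := l *: (x : 'rV[R]_n) + v.

Lemma measurable_affine n l (v : 'rV[R]_n) : measurable_fun setT (affine l v).
Proof.
apply: measurable_eucl => i.
rewrite (_ : (fun _ => _) = fun t : eucl R n => l * (t : 'rV[R]_n) 0 i + v 0 i).
  apply: measurable_funD => //; apply: measurable_funM => //.
  exact: measurable_coord.
by apply/funext => t; rewrite !mxE.
Qed.

Lemma affine_cons_row n l (v : 'rV[R]_n.+1) p :
  affine l v (cons_row p) =
  cons_row (affine1 l (v 0 0) p.1, affine l (rsubmx (v : 'rV[R]_(1 + n))) p.2).
Proof.
rewrite /affine /cons_row /affine1 /=.
apply/rowP => i; have [j ->|j ->] := @split_ordP 1 n i.
  have E (a : R) (w : 'rV[R]_n) : (row_mx a%:M w : 'rV[R]_(1 + n)) 0 (lshift n j) = a.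
    by rewrite (row_mxEl (a%:M : 'M[R]_1)) mxE !ord1 eqxx.
  rewrite E 2!mxE E; congr (_ + v 0 _); by apply/val_inj => /=; rewrite ord1.
have E (a : R) (w : 'rV[R]_n) : (row_mx a%:M w : 'rV[R]_(1 + n)) 0 (rshift 1 j) = w 0 j.
  by rewrite row_mxEr.
by rewrite E 2!mxE E !mxE.
Qed.

(** Induction along R^(n+1) = R x R^n: the map acts separately on the first coordinate and on the
    tail, so the induction hypothesis scales each section and the one-dimensional case scales the
    outer integral. *)
Lemma lebesgue_eucl_affine n l (v : 'rV[R]_n) (A : set (eucl R n)) : 0 < l ->
  measurable A ->
  (lebesgue_eucl R n (affine l v @^-1` A) = (l ^- n)%:E * lebesgue_eucl R n A)%E.
Proof.
move=> l0; elim: n v A => [|n IH] v A mA.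
  rewrite expr0 invr1 mul1e (_ : affine l v @^-1` A = A)//.
  have E (x : eucl R 0) : affine l v x = x by apply/rowP => -[].
  by apply/seteqP; split => x /=; rewrite E.
rewrite /= /lebesgue_step /pushforward.
set B := @cons_row R n @^-1` A.
have mB : measurable B.
  by rewrite -[X in measurable X]setTI; exact: measurable_cons_row.
set v' := rsubmx (v : 'rV[R]_(1 + n)); set v0 : R := v 0 0.
rewrite /product_measure1.
have mphi := measurable_fun_xsection (lebesgue_eucl R n) mB.
transitivity (\int[lebesgue_measure]_x
    ((l ^- n)%:E * ((lebesgue_eucl R n \o xsection B) \o affine1 l v0) x))%E.
  apply: eq_integral => x _ /=.
  rewrite -(IH v'); last exact: measurable_xsection.
  congr (lebesgue_eucl R n _); apply/seteqP; split => y /=;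
    by rewrite /xsection /= !inE /= affine_cons_row.
rewrite ge0_integralZl//; last 2 first.
- apply: measurableT_comp => //; exact: measurable_affine1.
- by rewrite lee_fin invr_ge0 exprn_ge0// ltW.
have H := ge0_integral_pushforward (measurable_affine1 l v0) (@lebesgue_measure R)
  (D := setT) measurableT mphi.
rewrite preimage_setT in H; rewrite -H; last by move=> y _; exact: measure_ge0.
pose mf : {mfun measurableTypeR R >-> measurableTypeR R} :=
  HB.pack (affine1 l v0) (isMeasurableFun.Build _ _ _ _ _ (measurable_affine1 l v0)).
have li : 0 <= l^-1 by rewrite invr_ge0 ltW.
have -> : (\int[pushforward lebesgue_measure mf]_x (lebesgue_eucl R n \o xsection B) x =
  \int[mscale (NngNum li) (@lebesgue_measure R)]_x (lebesgue_eucl R n \o xsection B) x)%E.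
  apply: eq_measure_integral => X mX _.
  by rewrite /pushforward [LHS]lebesgue_measure_affine.
rewrite ge0_integral_mscale//= muleA -EFinM; congr (EFin _ * _)%E.
by rewrite exprS invfM mulrC.
Qed.

(** The library norm is the sup norm, so its unit ball is the product of an interval and the unit
    ball one dimension lower. *)
Lemma lebesgue_eucl_ball1 n : (lebesgue_eucl R n (ball 0%R 1%R) < +oo)%E.
Proof.
elim: n => [|n IH]; first by rewrite /= diracE ltry.
have mb : measurable (ball (0 : 'rV[R]_n) 1 : set (eucl R n)).
  by apply: sub_sigma_algebra; exact: ball_open.
have mI : measurable (ball (0 : R) 1 : set (measurableTypeR R)) by exact: measurable_ball.
have -> : lebesgue_eucl R n.+1 (ball (0 : 'rV[R]_n.+1) 1) =
   (@lebesgue_measure R \x lebesgue_eucl R n)%E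
     ((ball 0%R 1%R : set (measurableTypeR R)) `*` (ball 0%R 1%R)).
  rewrite /= /lebesgue_step /pushforward; congr (_ _).
  apply/seteqP; split => -[a w] /=; rewrite /cons_row /=.
    move=> [_ H]; split.
      have := H 0 (lshift n (0 : 'I_1)).
      by rewrite (row_mxEl (a%:M : 'M[R]_1)) mxE mxE eqxx.
    by split => // i j; have := H 0 (rshift 1 j); rewrite (row_mxEr (a%:M : 'M[R]_1) (w : 'rV[R]_n)) ord1 mxE mxE.
  move=> [H1 [_ H2]]; split => // i j; rewrite ord1.
  have [k ->|k ->] := @split_ordP 1 n j.
    by rewrite (row_mxEl (a%:M : 'M[R]_1)) mxE mxE !ord1 eqxx.
  by rewrite (row_mxEr (a%:M : 'M[R]_1) (w : 'rV[R]_n)); have := H2 0 k; rewrite mxE mxE.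
rewrite product_measure1E// lte_mul_pinfty//.
have H : (@lebesgue_measure R (ball (0 : R) (1 : R)) \is a fin_num)%R.
  by rewrite (@lebesgue_measure_ball R 0 1 ler01).
exact: H.
Qed.

End LebesgueScaling.

(** Serves twice: for the packing of homothetic copies and for the cardinality of separated sets. *)
Lemma mul_le_measure d (T : measurableType d) (R : realType)
    (mu : {measure set T -> \bar R}) n (F : 'I_n -> set T) (B : set T) (m : \bar R) :
  (forall i, measurable (F i)) -> trivIset setT F -> measurable B ->
  (forall i, F i `<=` B) -> (forall i, (m <= mu (F i))%E) ->
  (n%:R%:E * m <= mu B)%E.
Proof.
move=> mF tF mB FB mm.
have mU : measurable (\big[setU/set0]_(i < n) F i) by apply: bigsetU_measurable.
apply: (@le_trans _ _ (mu (\big[setU/set0]_(i < n) F i))); last first.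
  apply: le_measure; rewrite ?inE//.
  by elim/big_ind: _ => // X Y XB YB x [/XB|/YB].
rewrite measure_semi_additive_ord//.
apply: (@le_trans _ _ (\sum_(i < n) m)%E); last by apply: lee_sum => i _; exact: mm.
by rewrite sumr_const card_ord mule_natl.
Qed.

(** * Packing by homothetic copies *)

Section HomotheticPacking.
Variable R : realType.

Lemma lebesgue_eucl_ball n (z : 'rV[R]_n) (r : R) : 0 < r ->
  lebesgue_eucl R n (ball z r) = ((r ^+ n)%:E * lebesgue_eucl R n (ball 0%R 1%R))%E.
Proof.
move=> r0.
have ri : 0 < r^-1 by rewrite invr_gt0.
rewrite -[r ^+ n]invrK -exprVn -(lebesgue_eucl_affine (- (r^-1 *: z)))//; last first.
  by apply: sub_sigma_algebra; exact: ball_open.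
congr (lebesgue_eucl R n _); apply/seteqP; split => y;
  rewrite -!ball_normE /ball_ /= /affine /= sub0r normrN -scalerBr normrZ gtr0_norm//
   ltr_pdivrMl// mulr1 distrC; done.
Qed.

(* The homothetic images of A with centre z0 and ratios 1 + j tau, where
   tau = 8 (b - a) / a and j tau <= 1, are pairwise disjoint, lie in the ball of radius
   2 rho, and have measure at least that of A. *)
Lemma homothetic_packing n (z0 : 'rV[R]_n) (g : 'rV[R]_n -> R) (A : set (eucl R n))
    (a b rho : R) :
  measurable A -> 0 < a -> a < b -> 0 < rho ->
  (forall z, A z -> a <= g z <= b) ->
  A `<=` ball z0 rho ->
  (forall z z' t, A z -> A z' -> 1 <= t -> z - z0 = t *: (z' - z0) ->
     (1 + (t - 1) / 2) * g z' <= g z) ->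
  (lebesgue_eucl R n A <=
     (16 * ((b - a) / a) * (2 * rho) ^+ n)%:E * lebesgue_eucl R n (ball 0%R 1%R))%E.
Proof.
move=> mA a0 ab rho0 Aab Arho gr.
have ba0 : 0 < (b - a) / a by rewrite divr_gt0// subr_gt0.
set t := 8 * ((b - a) / a).
have t0 : 0 < t by rewrite /t mulr_gt0.
set beta := lebesgue_eucl R n _.
have mball z r : measurable (ball z r : set (eucl R n)).
  by apply: sub_sigma_algebra; exact: ball_open.
have -> : (16 * ((b - a) / a) * (2 * rho) ^+ n)%:E = ((2 * t)%:E * ((2 * rho) ^+ n)%:E)%E.
  by rewrite -EFinM /t; congr EFin; ring.
rewrite -muleA -(@lebesgue_eucl_ball n z0) ?mulr_gt0//.
set Bm := lebesgue_eucl R n (ball z0 _).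
have Bm0 : (0 <= Bm)%E by exact: measure_ge0.
(* For t >= 1 the inclusion of [A] in the ball suffices, since 2 t >= 1. *)
have [t1|t1] := leP 1 t.
  apply: (@le_trans _ _ Bm).
    apply: le_measure; rewrite ?inE//.
    by apply: subset_trans Arho _; apply: le_ball; rewrite ler_peMl ?ler1n// ltW.
  rewrite -[leLHS]mul1e lee_wpmul2r// lee_fin.
  by rewrite (le_trans t1)// ler_peMl ?ler1n// ltW.
(* The copies j < M have ratio at most 2, hence stay in the ball of radius 2 rho. As t < 1, rounding
   down costs at most a factor 2: M >= 1 / (2 t). *)
set M := Num.truncn t^-1.
have M1 : M%:R * t <= 1.
  by rewrite -ler_pdivlMr// mul1r -truncn_ge_nat// invr_ge0 ltW.
have M2 : 1 <= 2 * t * M%:R.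
  have M1' : (1 <= M)%N by rewrite truncn_gt0 -[1]invr1 lef_pV2 ?posrE// ltW.
  have h : 1 < M.+1%:R * t by rewrite -ltr_pdivrMr// mul1r; exact: truncnS_gt.
  have h2 : M.+1%:R <= 2 * M%:R :> R.
    by rewrite -natrM ler_nat mul2n -addnn -addn1 leq_add2l.
  by nra.
pose lam (j : 'I_M) : R := 1 + j%:R * t.
have lam1 j : 1 <= lam j by rewrite /lam lerDl mulr_ge0// ltW.
have lam0 j : 0 < lam j by exact: lt_le_trans (lam1 j).
have lam2 j : lam j <= 2.
  rewrite /lam (_ : 2 = 1 + 1)// lerD2l (le_trans _ M1)//.
  by apply: ler_wpM2r; [exact: ltW|rewrite ler_nat ltnW].
pose F j := affine (lam j)^-1 (z0 - (lam j)^-1 *: z0) @^-1` A.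
have FE j x : affine (lam j)^-1 (z0 - (lam j)^-1 *: z0) x - z0 = (lam j)^-1 *: (x - z0).
  by apply/rowP => i; rewrite !mxE; ring.
have mF j : measurable (F j).
  by rewrite -[X in measurable X]setTI; exact: measurable_affine.
have A0 : (0 <= lebesgue_eucl R n A)%E by exact: measure_ge0.
have HM : (M%:R%:E * lebesgue_eucl R n A <= Bm)%E.
  apply: (mul_le_measure (F := F)) => //.
  (* A common point of the copies i < j comes from [w] and [w'] in [A] on one ray from [z0], with
     ratio at least 1 + t / 2. Then g w >= (1 + t / 4) a = a + 2 (b - a) > b, which is impossible;
     hence the factor 8 in [t]. *)
  - have aux (i j : 'I_M) x : (i < j)%N -> F i x -> F j x -> False.
      move=> ij; rewrite /F /=; set w := affine _ _ x; set w' := affine _ _ x => Aw Aw'.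
      have E : w - z0 = (lam j / lam i) *: (w' - z0).
        rewrite !FE scalerA; congr (_ *: _).
        by rewrite mulrAC mulfV ?gt_eqF// mul1r.
      have lij : lam i + t <= lam j.
        rewrite /lam -addrA lerD2l -[X in _ + X]mul1r -mulrDl.
        by apply: ler_wpM2r; [exact: ltW|rewrite natr1 ler_nat].
      have H1 : t / 2 <= lam j / lam i - 1.
        rewrite lerBrDr ler_pdivlMr//.
        have := lam2 i; have := lam1 i; nra.
      have t1' : 1 <= lam j / lam i by lra.
      have H2 := gr _ _ _ Aw Aw' t1' E.
      have /andP[h1 h2] := Aab _ Aw; have /andP[h3 h4] := Aab _ Aw'.
      have Ht : t * a = 8 * (b - a) by rewrite /t -mulrA divfK ?gt_eqF.
      by nra.
    apply/trivIsetP => i j _ _ ij; apply/seteqP; split => // x [Fi Fj].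
    have := ij; rewrite -val_eqE neq_ltn => /orP[] h.
      exact: (aux i j x).
    exact: (aux j i x).
  - move=> j x /Arho; rewrite -!ball_normE /= -normrN opprB FE normrZ gtr0_norm ?invr_gt0//.
    rewrite ltr_pdivrMl// -normrN opprB => h; apply: lt_le_trans h _.
    by rewrite ler_wpM2r// ltW.
  - move=> j; have li0 : 0 < (lam j)^-1 by rewrite invr_gt0.
    have E := lebesgue_eucl_affine (z0 - (lam j)^-1 *: z0) li0 mA.
    rewrite [leRHS](E : lebesgue_eucl R n (F j) = _) -[leLHS]mul1e.
    rewrite lee_wpmul2r// lee_fin exprVn invrK.
    exact: exprn_ege1.
apply: (@le_trans _ _ ((2 * t * M%:R)%:E * lebesgue_eucl R n A)%E).
  by rewrite -[leLHS]mul1e lee_wpmul2r// lee_fin.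
by rewrite EFinM -muleA lee_wpmul2l// lee_fin mulr_ge0// ltW.
Qed.

End HomotheticPacking.

(** * Euclidean geometry and strict differentiability *)

Section Norms.
Variable R : realType.
Implicit Types n d : nat.

Lemma ler_mx_entry m n (A : 'M[R]_(m, n)) i j : `|A i j| <= `|A|.
Proof.
have -> : `|A| = mx_norm A by [].
by rewrite mx_normrE (le_bigmax 0 (fun ij => `|A ij.1 ij.2|) (i, j)).
Qed.

Lemma mx_norm_le m n (A : 'M[R]_(m, n)) c :
  0 <= c -> (forall i j, `|A i j| <= c) -> `|A| <= c.
Proof.
move=> c0 h; have -> : `|A| = mx_norm A by [].
by rewrite mx_normrE; apply: bigmax_le.
Qed.

Lemma mulmx_norm_le m n p (A : 'M[R]_(m, n)) (B : 'M[R]_(n, p)) :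
  `|A *m B| <= n%:R * `|A| * `|B|.
Proof.
apply: mx_norm_le => [|i j]; first by rewrite !mulr_ge0.
rewrite mxE (le_trans (ler_norm_sum _ _ _))//.
apply: (@le_trans _ _ (\sum_(k < n) `|A| * `|B|)).
  by apply: ler_sum => k _; rewrite normrM ler_pM// ler_mx_entry.
by rewrite sumr_const card_ord -[leLHS]mulr_natl mulrA.
Qed.

Lemma enorm_ge0 d (x : 'rV[R]_d) : 0 <= enorm x.
Proof. exact: sqrtr_ge0. Qed.

Lemma sqr_enorm d (x : 'rV[R]_d) : enorm x ^+ 2 = \sum_(i < d) x 0 i ^+ 2.
Proof. by rewrite sqr_sqrtr// sumr_ge0// => i _; exact: sqr_ge0. Qed.

Lemma enorm0 d : enorm (0 : 'rV[R]_d) = 0.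
Proof.
by rewrite /enorm big1 ?sqrtr0// => i _; rewrite mxE expr0n.
Qed.

Lemma enormZ d a (x : 'rV[R]_d) : enorm (a *: x) = `|a| * enorm x.
Proof.
rewrite /enorm (eq_bigr (fun i => a ^+ 2 * x 0 i ^+ 2)); last first.
  by move=> i _; rewrite mxE exprMn.
by rewrite -mulr_sumr sqrtrM ?sqr_ge0// sqrtr_sqr.
Qed.

Lemma enormN d (x : 'rV[R]_d) : enorm (- x) = enorm x.
Proof. by rewrite -scaleN1r enormZ normrN1 mul1r. Qed.

Lemma enormB d (x y : 'rV[R]_d) : enorm (x - y) = enorm (y - x).
Proof. by rewrite -enormN opprB. Qed.

(** Cauchy-Schwarz, by expanding |b x - a y|^2 >= 0 with a = |x| and b = |y|, then dividing by a
    b. *)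
Lemma dotp_le d (x y : 'rV[R]_d) : dotp x y <= enorm x * enorm y.
Proof.
set a := enorm x; set b := enorm y.
have a0 : 0 <= a by exact: enorm_ge0.
have b0 : 0 <= b by exact: enorm_ge0.
have Ea := sqr_enorm x; have Eb := sqr_enorm y; rewrite -/a -/b in Ea Eb.
have H0 (z : 'rV[R]_d) : \sum_(i < d) z 0 i ^+ 2 = 0 -> forall i, z 0 i = 0.
  move=> h i; have := psumr_eq0P (fun i _ => sqr_ge0 (z 0 i)) h (i := i) isT.
  by move=> /eqP; rewrite sqrf_eq0 => /eqP.
have [a00|a00] := eqVneq a 0.
  rewrite a00 mul0r /dotp big1// => i _.
  by rewrite (H0 x) ?mul0r// -Ea a00 expr0n.
have [b00|b00] := eqVneq b 0.
  rewrite b00 mulr0 /dotp big1// => i _.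
  by rewrite (H0 y) ?mulr0// -Eb b00 expr0n.
have ap : 0 < a by rewrite lt0r a00.
have bp : 0 < b by rewrite lt0r b00.
have : 0 <= \sum_(i < d) (b * x 0 i - a * y 0 i) ^+ 2.
  by apply: sumr_ge0 => i _; exact: sqr_ge0.
rewrite (eq_bigr (fun i => b ^+ 2 * x 0 i ^+ 2 + (a ^+ 2 * y 0 i ^+ 2 +
   (- (2 * a * b)) * (x 0 i * y 0 i)))); last by move=> i _; ring.
rewrite !big_split /= -!mulr_sumr -Ea -Eb -/(dotp x y) => h.
have abp : 0 < a * b by rewrite mulr_gt0.
rewrite -(ler_pM2l abp); nra.
Qed.

Lemma enormD2 d (x y : 'rV[R]_d) :
  enorm (x + y) ^+ 2 = enorm x ^+ 2 + 2 * dotp x y + enorm y ^+ 2.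
Proof.
rewrite !sqr_enorm mulr_sumr -!big_split /=.
by apply: eq_bigr => i _; rewrite mxE; ring.
Qed.

Lemma ler_enormD d (x y : 'rV[R]_d) : enorm (x + y) <= enorm x + enorm y.
Proof.
rewrite -(@ler_pXn2r _ 2)// ?nnegrE ?addr_ge0 ?enorm_ge0//.
by rewrite enormD2; have := dotp_le x y; nra.
Qed.

Lemma ler_enormB d (z x y : 'rV[R]_d) : enorm (x - y) <= enorm (x - z) + enorm (z - y).
Proof. by rewrite (le_trans _ (ler_enormD _ _))// addrA subrK. Qed.

Lemma norm_le_enorm d (x : 'rV[R]_d) : `|x| <= enorm x.
Proof.
apply: mx_norm_le => [|i j]; first exact: enorm_ge0.
rewrite ord1 -(@ler_pXn2r _ 2)// ?nnegrE ?enorm_ge0//.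
rewrite sqr_enorm (bigD1 j)//= real_normK ?num_real// lerDl.
by apply: sumr_ge0 => k _; exact: sqr_ge0.
Qed.

Lemma enorm_le_norm d (x : 'rV[R]_d) : enorm x <= d%:R * `|x|.
Proof.
rewrite -(@ler_pXn2r _ 2)// ?nnegrE ?enorm_ge0 ?mulr_ge0//.
rewrite sqr_enorm (@le_trans _ _ (\sum_(i < d) `|x| ^+ 2))//.
  apply: ler_sum => i _; rewrite -real_normK ?num_real//.
  by rewrite ler_pXn2r// ?nnegrE// ler_mx_entry.
rewrite sumr_const card_ord -[leLHS]mulr_natl exprMn; apply: ler_wpM2r; first exact: sqr_ge0.
by rewrite -natrX ler_nat; case: d {x} => // d; rewrite -{1}[d.+1]expn1 leq_pexp2l.
Qed.

Lemma enorm_continuous d : continuous (@enorm R d).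
Proof.
move=> x; apply: (iffRL (@cvgrPdist_lt _ _ _ (nbhs x) _ (@enorm R d) (enorm x))) => e e0.
near=> y.
have h : d.+1%:R * `|x - y| < e.
  rewrite -ltr_pdivlMl// mulrC; near: y.
  by apply: cvgr_dist_lt => //; rewrite divr_gt0.
apply: le_lt_trans h.
apply: (@le_trans _ _ (enorm (x - y))).
  rewrite ler_norml; apply/andP; split.
    by have := ler_enormB x y 0; rewrite !subr0 enormB; lra.
  by have := ler_enormB y x 0; rewrite !subr0; lra.
by rewrite (le_trans (enorm_le_norm _))// ler_wpM2r// ler_nat.
Unshelve. all: by end_near.
Qed.

End Norms.

Section StrictDifferentiability.
Variable R : realType.

(** Mean value theorem on the segment from [z'] to [z], for each coordinate of [g] minus its linear
    part at [y]. Unlike differentiability at [y], this compares two arbitrary points of the ball, as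
    is needed for two points on a ray issued from a third one. *)
Lemma C1_on_strict n m (V : set 'rV[R]_n) (g : 'rV[R]_n -> 'rV[R]_m) y (eta : R) :
  open V -> C1_on V g -> V y -> 0 < eta ->
  exists2 del : R, 0 < del &
  ball y del `<=` V /\
  forall z z', ball y del z -> ball y del z' ->
    `|g z - g z' - (z - z') *m 'J g y| <= eta * `|z - z'|.
Proof.
move=> oV gC Vy eta0.
have [_ cJ] := gC _ Vy.
(* The matrix product loses a factor n; n + 1 also covers n = 0. *)
pose e := eta / n.+1%:R.
have e0 : 0 < e by rewrite divr_gt0.
have near1 : \forall z \near y, V z /\ `|'J g y - 'J g z| < e.
  near=> z; split; first by near: z; exact: open_nbhs_nbhs.
  by near: z; move/cvgrPdist_lt : cJ; apply.
have /nbhs_ballP[del /= del0 Hdel] := near1.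
exists del => //; split => [z /Hdel[]//|z z' Bz Bz'].
have seg (t : R) : t \in `[0, 1] -> ball y del (z' + t *: (z - z')).
  rewrite in_itv /= => /andP[t0 t1]; move: Bz Bz'; rewrite -!ball_normE /ball_ /= => Bz Bz'.
  have -> : y - (z' + t *: (z - z')) = (1 - t) *: (y - z') + t *: (y - z).
    by apply/rowP => i; rewrite !mxE; ring.
  rewrite (le_lt_trans (ler_normD _ _))// !normrZ (ger0_norm t0) ger0_norm ?subr_ge0//.
  have [t2|t2] := leP t (1 / 2).
    have h1 : 0 < (1 - t) * (del - `|y - z'|) by rewrite mulr_gt0// subr_gt0//; lra.
    have h2 : 0 <= t * (del - `|y - z|) by rewrite mulr_ge0// subr_ge0 ltW.
    lra.
  have h1 : 0 <= (1 - t) * (del - `|y - z'|) by rewrite mulr_ge0// subr_ge0// ltW.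
  have h2 : 0 < t * (del - `|y - z|) by rewrite mulr_gt0// ?subr_gt0//; lra.
  lra.
apply: mx_norm_le => [|i j]; first by rewrite mulr_ge0// ltW.
rewrite ord1 {i}.
set w := z - z' in seg *.
pose F (t : R) : R := (g (z' + t *: w) - t *: (w *m 'J g y)) 0 j.
pose dF (t : R) : R := (w *m ('J g (z' + t *: w) - 'J g y)) 0 j.
have dFP (t : R) : t \in `[0, 1] -> is_derive t 1 F (dF t).
  move=> /seg/Hdel[Vt _]; set p := z' + t *: w in Vt *.
  have [dg _] := gC _ Vt.
  have dgw : derivable g p w by exact: diff_derivable.
  have Egw : 'D_w g p = w *m 'J g p by rewrite deriveE// mul_rV_lin1.
  pose G (s : R) : R := g (z' + s *: w) 0 j.
  have EG : (fun h : R => h^-1 *: ((G \o shift t) (h *: 1) - G t)) =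
     (fun h : R => h^-1 *: (((fun x => g x 0 j) \o shift p) (h *: w) - g p 0 j)).
    apply/funext => h; rewrite /G /p /=; congr (_ *: (g _ 0 j - _)).
    by apply/rowP => i; rewrite !mxE /GRing.scale /=; ring.
  have dG : is_derive t 1 G ((w *m 'J g p) 0 j).
    split; first by rewrite /derivable EG; exact: (derivable_mxP _ _ _).1.
    by rewrite /derive EG -Egw derive_mx// mxE.
  pose a : R := (w *m 'J g y) 0 j.
  have -> : F = G - (a \*: id).
    apply/funext => s; rewrite /F mxE [X in _ + X]mxE [X in _ - X]mxE.
    by rewrite /G /a /= [X in _ - X]mulrC.
  have -> : dF t = (w *m 'J g p) 0 j - a *: (1 : R).
    by rewrite /dF mulmxBr mxE [X in _ + X]mxE /GRing.scale /= mulr1.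
  by apply: is_deriveB; apply: is_deriveZ.
have zw : z' + w = z by rewrite /w addrC subrK.
have [c cI] := @MVT_segment R F dF 0 1 ler01
   (fun x xI => dFP x (subset_itv_oo_cc xI)) (derivable_within_continuous (fun x xI => @ex_derive _ _ _ _ _ _ _ (dFP x xI))).
rewrite subr0 mulr1 /F !scale1r !scale0r addr0 subr0 zw => E.
have -> : (g z - g z' - w *m 'J g y) 0 j = dF c.
  by rewrite -E; move: (w *m 'J g y) => q; rewrite !mxE; ring.
have [_ Hc] := Hdel _ (seg _ cI).
apply: le_trans (ler_mx_entry _ _ _) _.
apply: le_trans (mulmx_norm_le _ _) _.
rewrite distrC in Hc.
have n1 : n.+1%:R != 0 :> R by rewrite pnatr_eq0.
have -> : eta * `|w| = n.+1%:R * `|w| * e by rewrite /e; field.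
by rewrite ler_pM ?mulr_ge0 ?ler_wpM2r ?ler_nat// ltW.
Unshelve. all: by end_near.
Qed.

End StrictDifferentiability.

(** * Volume and mass of annuli *)

Section MonotoneIntegral.
Local Open Scope ereal_scope.

(* Monotonicity holds without measurability, the integral of a nonnegative
   function being a supremum over simple functions. *)
Lemma ge0_le_integral_nonmeas d (T : measurableType d) (R : realType)
    (mu : {measure set T -> \bar R}) (D : set T) (f g : T -> \bar R) :
  (forall x, D x -> 0 <= f x) -> (forall x, D x -> f x <= g x) ->
  \int[mu]_(x in D) f x <= \int[mu]_(x in D) g x.
Proof.
move=> f0 fg.
have g0 x : D x -> 0 <= g x by move=> Dx; rewrite (le_trans (f0 _ Dx))// fg.
rewrite integral_mkcond [leRHS]integral_mkcond.
rewrite !ge0_integralTE; last 2 first.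
- by apply: erestrict_ge0.
- by apply: erestrict_ge0.
apply: le_ereal_sup => _ [h hf <-]; exists h => // x.
apply: le_trans (hf x) _; rewrite !patchE; case: ifPn => // /set_mem.
exact: fg.
Qed.

End MonotoneIntegral.

Section ChartAnnulus.
Variable R : realType.

Lemma det_norm_le n (A : 'M[R]_n) : `|\det A| <= n`!%:R * `|A| ^+ n.
Proof.
rewrite /determinant (le_trans (ler_norm_sum _ _ _))//.
apply: (@le_trans _ _ (\sum_(s : 'S_n) `|A| ^+ n)).
  apply: ler_sum => s _; rewrite normrM normrX normrN1 expr1n mul1r normr_prod.
  rewrite -[X in _ ^+ X]card_ord -prodr_const.
  by apply: ler_prod => i _; rewrite normr_ge0 ler_mx_entry.
by rewrite sumr_const -[leLHS]mulr_natl card_Sn.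
Qed.

Lemma continuous_measurable_eucl n (f : 'rV[R]_n -> R) :
  continuous f -> measurable_fun [set: eucl R n] (f : eucl R n -> R).
Proof.
move=> cf; apply: (measurability _ (RGenOpens.measurableE R)) => _ [_ [a [b ->]] <-].
rewrite setTI; apply: sub_sigma_algebra.
by apply: (@open_comp _ _ f); [move=> x _; exact: cf|exact: interval_open].
Qed.

Lemma enorm_sub_continuous d (x : 'rV[R]_d) :
  continuous (fun w : 'rV[R]_d => enorm (w - x)).
Proof.
move=> w; apply: (@continuous_comp _ _ _ (fun w : 'rV[R]_d => w - x) (@enorm R d)).
  exact: (cvgB (@cvg_id _ (nbhs w)) (cvg_cst x)).
exact: enorm_continuous.
Qed.

Definition annulus d (x : 'rV[R]_d) (a b : R) : set 'rV[R]_d :=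
  [set w | a <= enorm (w - x) <= b].

Lemma measurable_half_part n (W : set 'rV[R]_n) :
  open W -> measurable (half_part W : set (eucl R n)).
Proof.
move=> oW.
have -> : half_part W = W `&`
  \bigcap_(i in [set i : 'I_n | nat_of_ord i = 0%N])
     ((fun y : eucl R n => (y : 'rV[R]_n) 0 i) @^-1` `[0, +oo[%classic).
  apply/seteqP; split => y [Wy h]; split => // i /= i0.
    by rewrite in_itv/= andbT; exact: h.
  by have := h i i0; rewrite /= in_itv/= andbT.
apply: measurableI; first exact: sub_sigma_algebra.
apply: fin_bigcap_measurable => // i _.
by rewrite -[X in measurable X]setTI; apply: measurable_coord.
Qed.

Lemma open_within_preimage n m (W : set 'rV[R]_n) (psi : 'rV[R]_n -> 'rV[R]_m)
    (O : set 'rV[R]_m) :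
  open W -> (forall z, W z -> {for z, continuous psi}) -> open O ->
  open (W `&` psi @^-1` O).
Proof.
move=> oW cW oO; rewrite openE => z [Wz Oz]; rewrite /interior.
apply: filterI; first exact: open_nbhs_nbhs.
by apply: (cW _ Wz); exact: open_nbhs_nbhs.
Qed.

Lemma open_enorm_lt d (x : 'rV[R]_d) (a : R) : open [set w : 'rV[R]_d | enorm (w - x) < a].
Proof.
have c := @enorm_sub_continuous d x.
exact: (open_comp (fun w _ => c w) (@open_lt R a)).
Qed.

Lemma open_enorm_gt d (x : 'rV[R]_d) (a : R) : open [set w : 'rV[R]_d | a < enorm (w - x)].
Proof.
have c := @enorm_sub_continuous d x.
exact: (open_comp (fun w _ => c w) (@open_gt R a)).
Qed.

(** Since [psi] is known to be continuous on [W] only, the closed conditions are expressed by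
    removing open subsets of [W]. *)
Lemma measurable_half_annulus n d (W : set 'rV[R]_n) (psi : 'rV[R]_n -> 'rV[R]_d) x a b :
  open W -> (forall z, W z -> {for z, continuous psi}) ->
  measurable (half_part W `&` psi @^-1` annulus x a b : set (eucl R n)).
Proof.
move=> oW cW.
have m1 : measurable (W `&` psi @^-1` [set w | enorm (w - x) < a] : set (eucl R n)).
  by apply: sub_sigma_algebra; apply: open_within_preimage => //; exact: open_enorm_lt.
have m2 : measurable (W `&` psi @^-1` [set w | b < enorm (w - x)] : set (eucl R n)).
  by apply: sub_sigma_algebra; apply: open_within_preimage => //; exact: open_enorm_gt.
have -> : half_part W `&` psi @^-1` annulus x a b =
  half_part W `\` ((W `&` psi @^-1` [set w | enorm (w - x) < a]) `|`
     (W `&` psi @^-1` [set w | b < enorm (w - x)])).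
  apply/seteqP; split => z /= [[Wz hz]].
    by move=> /andP[h1 h2]; split => // -[[_]|[_]]; rewrite ltNge ?h1 ?h2.
  move=> h; split => //; rewrite /annulus /= !leNgt; apply/andP; split; apply/negP => h'; apply: h.
    by left.
  by right.
apply: measurableD; first exact: measurable_half_part.
exact: measurableU.
Qed.

Lemma measurable_annulus d (x : 'rV[R]_d) a b : measurable (annulus x a b : set (eucl R d)).
Proof.
have -> : annulus x a b = (fun w : eucl R d => enorm ((w : 'rV[R]_d) - x)) @^-1` `[a, b].
  by apply/seteqP; split => w; rewrite /= in_itv.
rewrite -[X in measurable X]setTI; apply: continuous_measurable_eucl => //.
exact: enorm_sub_continuous.
Qed.

(** Near [zp] the map [psi] is almost linear, so the distance from psi z to x is comparable to |z -
    z0| and grows along the rays from [z0]; this is what the packing asks for. The Jacobian factor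
    is bounded near [zp] by continuity. *)
Lemma chart_annulus d d' (N : set 'rV[R]_d) V (psi : 'rV[R]_d' -> 'rV[R]_d) zp :
  local_param N V psi -> half_part V zp ->
  exists r0 C : R, [/\ 0 < r0, 0 < C &
    forall vol : {measure set (eucl R d) -> \bar R}, is_volume_measure d' N vol ->
    forall x a b, N x -> enorm (x - psi zp) < r0 -> 0 < a -> a < b -> b <= r0 ->
      (vol (N `&` annulus x a b) <= (C * ((b - a) / a) * b ^+ d')%:E)%E].
Proof.
move=> lp [Vzp hzp]; have [oV [psiC _] rf injpsi opsi] := lp.
set J0 := 'J psi zp.
have J0B : J0 *m pinvmx J0 = 1%:M by apply: mulmxVp; exact: rf.
set B := pinvmx J0 in J0B.
(* Lower bound of the linear part, read off its right inverse [B]; the 1 keeps the denominator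
   positive. *)
pose m := (d%:R * `|B| + 1)^-1.
have m0' : 0 < d%:R * `|B| + 1 by rewrite ltr_wpDl// mulr_ge0.
have m0 : 0 < m by rewrite invr_gt0.
have mP (w : 'rV[R]_d') : m * `|w| <= `|w *m J0|.
  rewrite /m ler_pdivrMl// -{1}[w]mulmx1 -J0B mulmxA.
  rewrite (le_trans (mulmx_norm_le _ _))// mulrDl mul1r mulrAC.
  by rewrite lerDl.
(* Chosen so that m - eta is at least both m / 2, for the comparison with |z - z0|, and 4 d eta, for
   the growth along rays; d is the cost of passing from the sup norm to the Euclidean one. *)
pose eta := m / (4 * d%:R + 2).
have dd0 : 0 < 4 * d%:R + 2 :> R by rewrite ltr_wpDl// mulr_ge0.
have eta0 : 0 < eta by rewrite divr_gt0.
have etaE : eta * (4 * d%:R + 2) = m by rewrite divfK// gt_eqF.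
have [del del0 [delV strict]] := C1_on_strict oV psiC Vzp eta0.
have [_ cJ] := psiC _ Vzp.
have /nbhs_ballP[del1 /= del10 Hdel1] : \forall z \near zp, `|J0 - 'J psi z| < 1.
  by near=> z; near: z; move/cvgrPdist_lt : cJ; apply.
pose del2 := Num.min del del1.
have del20 : 0 < del2 by rewrite lt_min del0.
pose W := ball zp del2.
have W1 : W `<=` ball zp del by apply: le_ball; rewrite ge_min lexx.
have W2 : W `<=` ball zp del1 by apply: le_ball; rewrite ge_min lexx orbT.
have WV : W `<=` V by exact: subset_trans delV.
have oW : open W by exact: ball_open.
have cW z : W z -> {for z, continuous psi}.
  by move=> /WV /psiC [dz _]; exact: differentiable_continuous.
pose Jb := `|J0| + 1.
have Jb0 : 0 <= Jb by rewrite addr_ge0.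
pose D := Num.sqrt (d'`!%:R * (d%:R * Jb * Jb) ^+ d').
have DP z : W z -> Num.sqrt (\det ('J psi z *m ('J psi z)^T)) <= D.
  move=> /W2 /Hdel1 h; rewrite /D ler_wsqrtr//.
  have JJ : `|'J psi z| <= Jb.
    rewrite -[X in `|X|](subrK J0) (le_trans (ler_normD _ _))// addrC lerD2l.
    by rewrite distrC ltW.
  have JT : `|('J psi z)^T| <= Jb.
    by apply: mx_norm_le => // i j; rewrite mxE (le_trans (ler_mx_entry _ _ _)).
  rewrite (le_trans (ler_norm _))// (le_trans (det_norm_le _))// ler_wpM2l//.
  rewrite lerXn2r ?nnegrE ?mulr_ge0// (le_trans (mulmx_norm_le _ _))//.
  by rewrite ler_pM ?mulr_ge0// ler_wpM2l.
have [U oU psiU] := opsi W oW WV.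
have Up : U (psi zp).
  have : (N `&` U) (psi zp) by rewrite -psiU; exists zp => //; split => //; exact: ballxx.
  by case.
have /nbhs_ballP[r1 /= r10 Ur1] : nbhs (psi zp) U by exact: open_nbhs_nbhs.
pose beta := fine (lebesgue_eucl R d' (ball 0 1)).
have betaE : lebesgue_eucl R d' (ball 0 1) = beta%:E.
  by rewrite fineK// ge0_fin_numE// lebesgue_eucl_ball1.
have beta0 : 0 <= beta by rewrite fine_ge0.
have D0 : 0 <= D by exact: sqrtr_ge0.
(* As |x - psi zp| and b are at most r1 / 2, the points of N within b of x lie in [U], hence in the
   image of [W]. The factor 16 (6 / m)^d' is that of the packing with rho = 3 b / m; the 1 makes the
   constant positive. *)
exists (r1 / 2), (D * 16 * (6 / m) ^+ d' * beta + 1); split.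
- by rewrite divr_gt0.
- by rewrite ltr_wpDl// !mulr_ge0// exprn_ge0// divr_ge0// ltW.
move=> vol volN x a b Nx xr0 a0 ab br0.
have b0 : 0 < b by exact: lt_trans ab.
have NU w : N w -> enorm (w - x) <= b -> exists2 z, half_part W z & psi z = w.
  move=> Nw wx; have : (N `&` U) w.
    split => //; apply: Ur1; rewrite -ball_normE /ball_ /= -normrN opprB.
    rewrite (le_lt_trans (norm_le_enorm _))// (le_lt_trans (ler_enormB x _ _))//.
    lra.
  by rewrite -psiU => -[z Wz <-]; exists z.
have [z0 [Wz0 hz0] psiz0] : exists2 z, half_part W z & psi z = x.
  by apply: NU => //; rewrite subrr enorm0 ltW.
pose A := half_part W `&` psi @^-1` annulus x a b.
have mA : measurable (A : set (eucl R d')) by exact: measurable_half_annulus.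
have -> : N `&` annulus x a b = psi @` A.
  apply/seteqP; split => [w [Nw Aw]|_ [z [Wz Az] <-]].
    have [z Wz zw] := NU w Nw (proj2 (andP Aw)).
    by exists z => //; split => //=; rewrite zw.
  split => //.
  have : (N `&` U) (psi z) by rewrite -psiU; exists z.
  by case.
rewrite (volN.2 V psi lp A mA); last by move=> z [[Wz hz] _]; split => //; exact: WV.
apply: (@le_trans _ _ (\int[lebesgue_eucl R d']_(y in A) D%:E)%E).
  apply: ge0_le_integral_nonmeas => z; first by rewrite lee_fin sqrtr_ge0.
  by move=> [[Wz _] _]; rewrite lee_fin DP.
rewrite integral_cst//.
pose g z := enorm (psi z - x).
have glow0 z : W z -> (m - eta) * `|z - z0| <= g z.
  move=> Wz; have := strict z z0 (W1 _ Wz) (W1 _ Wz0); rewrite psiz0 => h.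
  rewrite /g (le_trans _ (norm_le_enorm _))//.
  have h1 := mP (z - z0).
  have h2 := ler_normD (psi z - x) (- (psi z - x - (z - z0) *m J0)).
  have h3 : psi z - x - (psi z - x - (z - z0) *m J0) = (z - z0) *m J0.
    by rewrite subKr.
  rewrite normrN h3 in h2; rewrite mulrBl; lra.
have d0 : 0 <= d%:R :> R by [].
have glow z : W z -> m / 2 * `|z - z0| <= g z.
  by move=> Wz; apply: le_trans (glow0 z Wz); apply: ler_wpM2r => //; nra.
have glow4 z : W z -> 4 * d%:R * eta * `|z - z0| <= g z.
  by move=> Wz; apply: le_trans (glow0 z Wz); apply: ler_wpM2r => //; nra.
have rho0 : 0 < 3 / m * b by rewrite mulr_gt0// divr_gt0.
have gA z : A z -> a <= g z <= b by case.
(* Here m / 2 |z - z0| <= g z <= b; 3 instead of 2 gives the strict inequality. *)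
have Arho : A `<=` ball z0 (3 / m * b).
  move=> z [[Wz _]] /andP[_ zb]; rewrite -ball_normE /ball_ /= distrC.
  by rewrite mulrAC ltr_pdivlMr//; have := glow z Wz; rewrite /g; lra.
have gr z z' t : A z -> A z' -> 1 <= t -> z - z0 = t *: (z' - z0) ->
     (1 + (t - 1) / 2) * g z' <= g z.
  move=> [[Wz _] _] [[Wz' _] _] t1 E.
  have t10 : 0 <= t - 1 by rewrite subr_ge0.
  have E' : z - z' = (t - 1) *: (z' - z0).
    by rewrite scalerBl scale1r -E opprB addrA subrK.
  have h1 := strict z z' (W1 _ Wz) (W1 _ Wz').
  have h2 := strict z' z0 (W1 _ Wz') (W1 _ Wz0); rewrite psiz0 in h2.
  (* The linear parts cancel in [q] because z - z0 = t (z' - z0), so only linearization errors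
     remain. They cost half of the growth, whence the factor 1 + (t - 1) / 2. *)
  pose q := psi z - x - t *: (psi z' - x).
  have qE : q = (psi z - psi z' - (z - z') *m J0)
       - (t - 1) *: (psi z' - x - (z' - z0) *m J0).
    rewrite E' -scalemxAl; move: ((z' - z0) *m J0) => u.
    by apply/rowP => i; rewrite !mxE; ring.
  have qle : `|q| <= 2 * eta * ((t - 1) * `|z' - z0|).
    rewrite qE (le_trans (ler_normB _ _))// normrZ (ger0_norm t10).
    move: h1; rewrite {2}E' normrZ (ger0_norm t10) => h1.
    have : (t - 1) * `|psi z' - x - (z' - z0) *m J0| <= (t - 1) * (eta * `|z' - z0|).
      by rewrite ler_wpM2l.
    lra.
  have qe : enorm q <= (t - 1) / 2 * g z'.
    rewrite (le_trans (enorm_le_norm _))//.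
    apply: (@le_trans _ _ (d%:R * (2 * eta * ((t - 1) * `|z' - z0|)))).
      by rewrite ler_wpM2l.
    have := ler_wpM2l t10 (glow4 z' Wz'); lra.
  have : t * g z' <= g z + enorm q.
    rewrite -(ger0_norm (le_trans ler01 t1)) /g -enormZ.
    have -> : t *: (psi z' - x) = (psi z - x) + - q by rewrite /q subKr.
    by rewrite -(enormN q) ler_enormD.
  lra.
have := homothetic_packing mA a0 ab rho0 gA Arho gr.
rewrite betaE => HA; apply: (@le_trans _ _ (D%:E * (16 * ((b - a) / a) * (2 * (3 / m * b)) ^+ d' * beta)%:E)%E).
  by rewrite lee_wpmul2l// EFinM.
rewrite -EFinM lee_fin.
have -> : 2 * (3 / m * b) = 6 / m * b by rewrite !mulrA -natrM.
rewrite exprMn.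
have ba0 : 0 <= (b - a) / a * b ^+ d'.
  by rewrite mulr_ge0 ?exprn_ge0 ?divr_ge0 ?subr_ge0// ltW.
have -> : D * (16 * ((b - a) / a) * ((6 / m) ^+ d' * b ^+ d') * beta) =
  D * 16 * (6 / m) ^+ d' * beta * ((b - a) / a * b ^+ d') by ring.
by rewrite -[leRHS]mulrA ler_wpM2r// lerDl.
Unshelve. all: by end_near.
Qed.

End ChartAnnulus.

Section MassOfAnnuli.
Variable R : realType.

(** Radius and constant are merged into one integer n, the claim getting weaker as n grows; near
    each point of N it holds for all large n, and compactness makes n uniform. *)
Lemma volume_annulus d d' (N : set 'rV[R]_d) :
  C2_submanifold d' N -> compact N ->
  exists r0 C : R, [/\ 0 < r0, 0 < C &
    forall vol : {measure set (eucl R d) -> \bar R}, is_volume_measure d' N vol ->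
    forall x a b, N x -> 0 < a -> a < b -> b <= r0 ->
      (vol (N `&` annulus x a b) <= (C * ((b - a) / a) * b ^+ d')%:E)%E].
Proof.
move=> sN cN.
pose L (n : nat) (x : 'rV[R]_d) := N x ->
  forall vol : {measure set (eucl R d) -> \bar R}, is_volume_measure d' N vol ->
    forall a b, 0 < a -> a < b -> b <= n.+1%:R^-1 ->
      (vol (N `&` annulus x a b) <= (n.+1%:R * ((b - a) / a) * b ^+ d')%:E)%E.
have [n _ Hn] : \forall n \near \oo, N `<=` L n.
  apply: (iffLR (compact_near_coveringP N)) => // p Np.
  have [V [psi [lp [zp Vzp <-]]]] := sN p Np.
  have [r0 [C [r00 C0 H]]] := chart_annulus lp Vzp.
  have [n1 n1P] : exists n1 : nat, C + r0^-1 <= n1%:R.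
    by exists (Num.truncn (C + r0^-1)).+1; rewrite ltW// truncnS_gt.
  exists ([set x : 'rV[R]_d | enorm (x - psi zp) < r0], [set n | (n1 <= n)%N]).
    split; last by exists n1.
    apply: open_nbhs_nbhs; split; first exact: open_enorm_lt.
    by rewrite /= subrr enorm0.
  move=> [x n] /= [xr0 n1n] Nx vol volN a b a0 ab bn.
  have nC : C + r0^-1 <= n.+1%:R.
    by rewrite (le_trans n1P)// ler_nat (leq_trans n1n).
  have ri0 : 0 < r0^-1 by rewrite invr_gt0.
  apply: le_trans (H vol volN x a b Nx xr0 a0 ab _) _.
    rewrite (le_trans bn)// -[leRHS]invrK lef_pV2 ?posrE//; lra.
  rewrite lee_fin -mulrA -[leRHS]mulrA; apply: ler_wpM2r; last lra.
  have b0 : 0 <= b by rewrite ltW// (lt_trans a0).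
  by rewrite mulr_ge0 ?exprn_ge0// divr_ge0 ?subr_ge0// ltW.
exists n.+1%:R^-1, n.+1%:R; split => // vol volN x a b Nx.
by apply: (Hn n) => //=.
Qed.

Lemma measurable_compact d (N : set 'rV[R]_d) : compact N -> measurable (N : set (eucl R d)).
Proof.
move=> cN; rewrite -[N]setCK; apply: measurableC; apply: sub_sigma_algebra.
rewrite openC; by apply: compact_closed => //; exact: norm_hausdorff.
Qed.

Lemma mass_annulus d d' (N : set 'rV[R]_d) :
  C2_submanifold d' N -> compact N ->
  exists r0 C : R, [/\ 0 < r0, 0 < C &
    forall (P : probability (eucl R d) R) f (fmax : R),
    has_density d' N P f -> (forall x, N x -> 0 <= f x <= fmax) ->
    forall x a b, N x -> 0 < a -> a < b -> b <= r0 ->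
      (P (annulus x a b) <= (fmax * C * ((b - a) / a) * b ^+ d')%:E)%E].
Proof.
move=> sN cN; have [r0 [C [r00 C0 H]]] := volume_annulus sN cN.
exists r0, C; split => // P f fmax [mf [vol volN PE]] f01 x a b Nx a0 ab br0.
have /andP[f0 f1] := f01 x Nx.
have fm0 : 0 <= fmax by exact: le_trans f1.
have mA := measurable_annulus x a b.
have mN := measurable_compact cN.
rewrite PE//; apply: (@le_trans _ _ (\int[vol]_(y in annulus x a b `&` N) fmax%:E)%E).
  apply: ge0_le_integral_nonmeas => y [_ /f01/andP[]]; by rewrite lee_fin.
rewrite integral_cst//; last exact: measurableI.
have -> : fmax * C * ((b - a) / a) * b ^+ d' = fmax * (C * ((b - a) / a) * b ^+ d') by ring.
by rewrite EFinM lee_wpmul2l// setIC; exact: H.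
Qed.

End MassOfAnnuli.

(** * The distance to measure as a second moment *)

Section TailComparison.
Variable R : realType.

(** Layer-cake formula. The two variables live on different spaces: later, the uniform law on [0, h]
    and a law on R^d. *)
Lemma ge0_le_integral_tail d1 (T1 : measurableType d1) (P1 : probability T1 R)
    d2 (T2 : measurableType d2) (P2 : probability T2 R) (X1 : T1 -> R) (X2 : T2 -> R) :
  measurable_fun setT X1 -> measurable_fun setT X2 ->
  (forall t, 0 <= X1 t) -> (forall t, 0 <= X2 t) ->
  (forall r, 0 <= r -> (P1 [set t | (r < X1 t)%R] <= P2 [set t | (r < X2 t)%R])%E) ->
  (\int[P1]_t (X1 t)%:E <= \int[P2]_t (X2 t)%:E)%E.
Proof.
move=> m1 m2 X10 X20 H.
pose Y1 : {RV P1 >-> R} := HB.pack X1 (isMeasurableFun.Build _ _ _ _ _ m1).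
pose Y2 : {RV P2 >-> R} := HB.pack X2 (isMeasurableFun.Build _ _ _ _ _ m2).
have E1 := ge0_expectation_ccdf (X := Y1) X10.
have E2 := ge0_expectation_ccdf (X := Y2) X20.
rewrite expectation_def in E1; rewrite expectation_def in E2.
rewrite [leLHS]E1 [leRHS]E2.
apply: ge0_le_integral_nonmeas => r /=; rewrite in_itv /= andbT => r0.
  exact: measure_ge0.
have -> : ccdf Y1 r = P1 [set t | (r < X1 t)%R].
  by rewrite /ccdf /distribution /pushforward; congr (P1 _); apply/seteqP; split => t /=;
    rewrite in_itv /= andbT.
have -> : ccdf Y2 r = P2 [set t | (r < X2 t)%R].
  by rewrite /ccdf /distribution /pushforward; congr (P2 _); apply/seteqP; split => t /=;
    rewrite in_itv /= andbT.
exact: H.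
Qed.

Lemma uniform_probE (h : R) (h0 : 0 < h) (A : set (measurableTypeR R)) : measurable A ->
  (uniform_prob h0 A = h^-1%:E * @lebesgue_measure R (A `&` `[0%R, h]))%E.
Proof.
move=> mA; rewrite -[A in LHS]setIT -integral_indic// integral_uniform//; last first.
  by apply/measurable_EFinP; exact: measurable_indic.
by rewrite integral_indic// subr0.
Qed.

End TailComparison.

Section DistanceFunctions.
Variables (R : realType) (d : nat).
Implicit Types (P mu : probability (eucl R d) R) (x : 'rV[R]_d) (h l s : R).

Lemma measurable_ecball x s : measurable (ecball x s%:E : set (eucl R d)).
Proof.
have -> : ecball x s%:E = (fun w : eucl R d => enorm ((w : 'rV[R]_d) - x)) @^-1` `]-oo, s].
  by apply/seteqP; split => w; rewrite /ecball /= in_itv /= lee_fin.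
rewrite -[X in measurable X]setTI; apply: continuous_measurable_eucl => //.
exact: enorm_sub_continuous.
Qed.

Lemma measurable_eball x s : measurable (eball x s%:E : set (eucl R d)).
Proof.
have -> : eball x s%:E = (fun w : eucl R d => enorm ((w : 'rV[R]_d) - x)) @^-1` `]-oo, s[.
  by apply/seteqP; split => w; rewrite /eball /= in_itv /= lte_fin.
rewrite -[X in measurable X]setTI; apply: continuous_measurable_eucl => //.
exact: enorm_sub_continuous.
Qed.

Lemma delta_ge0 P l x : (0 <= delta P l x)%E.
Proof. by apply: le_ereal_inf_tmp => _ [r [r0 _] <-]; rewrite lee_fin ltW. Qed.

Lemma le_delta P l l' x : l <= l' -> (delta P l x <= delta P l' x)%E.
Proof.
move=> ll'; apply: le_ereal_inf_tmp => _ [r [r0 h] <-].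
apply: ereal_inf_lbound; exists r => //; split => //; by apply: le_lt_trans h; rewrite lee_fin.
Qed.

(** The radii in [delta] are positive while s may be 0, hence the slack e. *)
Lemma delta_le P l x s : 0 <= s -> (l%:E < P (ecball x s%:E))%E -> (delta P l x <= s%:E)%E.
Proof.
move=> s0 h; apply/lee_addgt0Pr => e e0; rewrite -EFinD.
apply: ereal_inf_lbound; exists (s + e) => //; split; first by rewrite ltr_wpDl.
apply: lt_le_trans h _; apply: le_measure; rewrite ?inE; try exact: measurable_ecball.
by move=> w; rewrite /ecball /= !lee_fin => /le_trans; apply; rewrite lerDl ltW.
Qed.

Lemma delta_lt P l x s : (delta P l x < s%:E)%E -> (l%:E < P (ecball x s%:E))%E.
Proof.
move=> /ereal_inf_lt [_ [r [r0 h] <-]]; rewrite lte_fin => rs.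
apply: lt_le_trans h _; apply: le_measure; rewrite ?inE; try exact: measurable_ecball.
by move=> w; rewrite /ecball /= !lee_fin => /le_trans; apply; exact: ltW.
Qed.

(** Continuity from above along the closed balls of radius s + 1 / (n + 1), each of mass greater
    than l. *)
Lemma le_mass_delta P l x s : (delta P l x <= s%:E)%E -> (l%:E <= P (ecball x s%:E))%E.
Proof.
move=> h.
have E : ecball x s%:E = \bigcap_n ecball x (s + n.+1%:R^-1)%:E.
  apply/seteqP; split => w; rewrite /ecball /= ?lee_fin.
    by move=> ws n _ /=; rewrite lee_fin (le_trans ws)// lerDl.
  move=> ws; apply/ler_addgt0Pr => e e0.
  have [n ne] : exists n : nat, n.+1%:R^-1 < e.
    near \oo => n; exists n.
    by near: n; apply: near_infty_natSinv_lt (PosNum e0).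
  by have := ws n Logic.I; rewrite /= lee_fin => /le_trans; apply; rewrite lerD2l ltW.
have mE n : measurable (ecball x (s + n.+1%:R^-1)%:E : set (eucl R d)).
  exact: measurable_ecball.
have cv := @nonincreasing_cvg_mu _ _ _ P (fun n => ecball x (s + n.+1%:R^-1)%:E)
  (le_lt_trans (probability_le1 P (mE 0%N)) (ltry _)) mE (bigcapT_measurable mE).
rewrite -E in cv.
have {}cv : P (ecball x (s + n.+1%:R^-1)%:E) @[n --> \oo] --> P (ecball x s%:E).
  apply: cv => m n mn; apply/subsetPset => w; rewrite /ecball /= !lee_fin.
  by move=> /le_trans; apply; rewrite lerD2l lef_pV2 ?posrE// ler_nat ltnS.
rewrite -(cvg_lim (@ereal_hausdorff R) cv); apply: lime_ge.
  by apply/cvg_ex; eexists; exact: cv.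
apply: nearW => n; apply: ltW; apply: delta_lt; apply: le_lt_trans h _.
by rewrite lte_fin ltrDl.
Unshelve. all: by end_near.
Qed.

Lemma delta_fin_num P l x K : P (~` eball 0 K%:E) = 0%E -> l < 1 ->
  delta P l x \is a fin_num.
Proof.
move=> PK l1; rewrite ge0_fin_numE ?delta_ge0//.
(* A closed ball about x of this radius contains the ball of radius K about 0, which has mass 1 >
   l. *)
apply: (@le_lt_trans _ _ (`|K| + enorm x)%:E); last exact: ltry.
apply: delta_le; first by rewrite addr_ge0 ?enorm_ge0.
have mK := measurable_eball 0 K.
have : P (eball 0 K%:E) = 1%E.
  by rewrite -[eball _ _]setCK probability_setC ?PK ?sube0//; exact: measurableC.
move=> P1; apply: (@lt_le_trans _ _ 1%E); first by rewrite lte_fin.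
rewrite -P1; apply: le_measure; rewrite ?inE//; first exact: measurable_ecball.
move=> w; rewrite /eball /ecball /= subr0 lte_fin lee_fin => wK.
have := ler_enormB 0 w x; rewrite subr0 sub0r enormN.
have := ler_norm K; lra.
Qed.

End DistanceFunctions.

Section DtmSecondMoment.
Variables (R : realType) (d : nat).
Implicit Types (P mu : probability (eucl R d) R) (x : 'rV[R]_d) (h l s : R).

Definition second_moment mu x : \bar R :=
  (\int[mu]_w (enorm ((w : 'rV[R]_d) - x) ^+ 2)%:E)%E.

Definition submeasure P h mu :=
  forall A : set (eucl R d), measurable A -> (h%:E * mu A <= P A)%E.

Lemma local_measure_submeasure P h t mu : 0 < h -> local_measure P h t mu -> submeasure P h mu.
Proof.
move=> h0 [Q [QP _ _ _ muQ]] A mA.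
by rewrite muQ// muleA -EFinM mulfV ?gt_eqF// mul1e QP.
Qed.

Section Uniform.
Variables (P : probability (eucl R d) R) (K h : R).
Hypotheses (PK : P (~` eball 0 K%:E) = 0%E) (h0 : 0 < h) (h1 : h < 1).

(* Clipping l at h makes this a finite nondecreasing function on the whole line. *)
Definition clipped_delta x l : R := fine (delta P (Num.min l h) x).

Lemma clipped_deltaE x l : (clipped_delta x l)%:E = delta P (Num.min l h) x.
Proof.
rewrite fineK// (delta_fin_num x PK)//.
by rewrite gt_min h1 orbT.
Qed.

Lemma clipped_delta_ge0 x l : 0 <= clipped_delta x l.
Proof. by rewrite fine_ge0// delta_ge0. Qed.

Lemma measurable_clipped_delta x :
  measurable_fun [set: measurableTypeR R] (clipped_delta x).
Proof.
apply: nondecreasing_measurable => // l l' ll'.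
rewrite -lee_fin !clipped_deltaE; apply: le_delta.
by rewrite le_min !ge_min ll' lexx orbT.
Qed.

(** The average over [0, h] becomes an expectation, so that tails can be compared. *)
Lemma dtm_sqrE x :
  (dtm P h x ^+ 2 = \int[uniform_prob h0]_l (clipped_delta x l ^+ 2)%:E)%E.
Proof.
rewrite /dtm sqr_sqrte; last first.
  by rewrite mule_ge0 ?lee_fin ?invr_ge0 ?(ltW h0)// integral_ge0// => l _; rewrite sqre_ge0.
rewrite integral_uniform; last 2 first.
- apply/measurable_EFinP; apply: measurable_funX; exact: measurable_clipped_delta.
- by move=> l; rewrite lee_fin sqr_ge0.
rewrite subr0; congr (_ * _)%E; apply: eq_integral => l.
rewrite inE /= in_itv /= => /andP[l0 lh].
by rewrite EFin_expe clipped_deltaE (min_idPl lh).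
Qed.

(** Compare tails at s, with p the mass of the closed ball of radius s. Levels l < p have [delta] at
    most s, so the uniform law gives at most max(1 - p / h, 0) to [delta] > s; as h mu <= P, mu
    gives at least that to the complement of the ball. *)
Lemma dtm_sqr_le x mu : submeasure P h mu -> (dtm P h x ^+ 2 <= second_moment mu x)%E.
Proof.
move=> muP; rewrite dtm_sqrE.
have mX2 : measurable_fun [set: measurableTypeR R] (fun l => clipped_delta x l ^+ 2).
  by apply: measurable_funX; exact: measurable_clipped_delta.
apply: ge0_le_integral_tail => //.
- apply: measurable_funX; apply: continuous_measurable_eucl; exact: enorm_sub_continuous.
- by move=> l; exact: sqr_ge0.
- by move=> w; exact: sqr_ge0.
move=> r r0; set s := Num.sqrt r.
have s0 : 0 <= s by exact: sqrtr_ge0.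
have rs : r = s ^+ 2 by rewrite sqr_sqrtr.
have mE := measurable_ecball x s.
have mX : measurable [set l : measurableTypeR R | r < clipped_delta x l ^+ 2].
  rewrite (_ : [set l | _] = (fun l => clipped_delta x l ^+ 2) @^-1` `]r, +oo[%classic).
    by rewrite -[X in measurable X]setTI; exact: mX2.
  by apply/seteqP; split => l /=; rewrite in_itv /= andbT.
have -> : [set w : eucl R d | r < enorm ((w : 'rV[R]_d) - x) ^+ 2] = ~` ecball x s%:E.
  apply/seteqP; split => w; rewrite /ecball /= lee_fin rs ltr_pXn2r// ?nnegrE ?enorm_ge0// ltNge;
    by [move/negP|move/negP].
rewrite [leLHS](uniform_probE h0 mX) probability_setC//.
set p := P (ecball x s%:E).
have pE : p = (fine p)%:E by rewrite fineK// fin_num_measure.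
have muE : mu (ecball x s%:E) = (fine (mu (ecball x s%:E)))%:E.
  by rewrite fineK// fin_num_measure.
have mup := muP _ mE.
rewrite -/p pE muE -EFinM lee_fin in mup.
set q := fine (mu _) in muE mup.
have q1 : q <= 1 by rewrite -lee_fin -muE probability_le1.
apply: (@le_trans _ _ (h^-1%:E * @lebesgue_measure R (`[fine p, h]))%E).
  rewrite lee_wpmul2l ?lee_fin ?invr_ge0 ?(ltW h0)//; apply: le_measure; rewrite ?inE//.
    exact: measurableI.
  move=> l [/= Xl]; rewrite !in_itv /= => /andP[l0 lh]; rewrite lh andbT.
  move: Xl; rewrite rs ltr_pXn2r// ?nnegrE ?clipped_delta_ge0// => Xl.
  rewrite leNgt; apply/negP => lp.
  have : (delta P l x <= s%:E)%E by apply: delta_le => //; rewrite -/p pE lte_fin.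
  by rewrite -{1}(min_idPl lh) -clipped_deltaE lee_fin leNgt Xl.
rewrite lebesgue_measure_itv /= lte_fin muE -EFinB.
case: ifPn => ph; last by rewrite mule0 lee_fin subr_ge0.
by rewrite -EFinB -EFinM lee_fin ler_pdivrMl// mulrBr mulr1 lerB.
Qed.

(** Same tails, reversed. Below the radius [delta P h x] the measure is P / h on the closed ball, so
    its tail is 1 - p / h, and all levels l > p have [delta] > s; from that radius on its tail
    vanishes. *)
Lemma local_measure_second_moment_le x mu : local_measure P h (FinitePoint x) mu ->
  (second_moment mu x <= dtm P h x ^+ 2)%E.
Proof.
move=> lm; have muP := local_measure_submeasure h0 lm.
have [Q [QP QT Qin Qout muQ]] := lm.
rewrite /= in Qin Qout.
rewrite dtm_sqrE.
have mX2 : measurable_fun [set: measurableTypeR R] (fun l => clipped_delta x l ^+ 2).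
  by apply: measurable_funX; exact: measurable_clipped_delta.
apply: ge0_le_integral_tail => //.
- apply: measurable_funX; apply: continuous_measurable_eucl; exact: enorm_sub_continuous.
- by move=> l; exact: sqr_ge0.
- by move=> w; exact: sqr_ge0.
move=> r r0; set s := Num.sqrt r.
have s0 : 0 <= s by exact: sqrtr_ge0.
have rs : r = s ^+ 2 by rewrite sqr_sqrtr.
have mE := measurable_ecball x s.
have mX : measurable [set l : measurableTypeR R | r < clipped_delta x l ^+ 2].
  rewrite (_ : [set l | _] = (fun l => clipped_delta x l ^+ 2) @^-1` `]r, +oo[%classic).
    by rewrite -[X in measurable X]setTI; exact: mX2.
  by apply/seteqP; split => l /=; rewrite in_itv /= andbT.
have -> : [set w : eucl R d | r < enorm ((w : 'rV[R]_d) - x) ^+ 2] = ~` ecball x s%:E.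
  apply/seteqP; split => w; rewrite /ecball /= lee_fin rs ltr_pXn2r// ?nnegrE ?enorm_ge0// ltNge;
    by [move/negP|move/negP].
have dhE : delta P h x = (clipped_delta x h)%:E by rewrite clipped_deltaE minxx.
set dh := clipped_delta x h in dhE.
have [sdh|dhs] := ltP s dh; last first.
  suff -> : mu (~` ecball x s%:E) = 0%E by exact: measure_ge0.
  have mEd := measurable_ecball x dh.
  have mC : measurable (~` ecball x s%:E : set (eucl R d)) by exact: measurableC.
  have mCd : measurable (~` ecball x dh%:E : set (eucl R d)) by exact: measurableC.
  have Q0 : Q (~` ecball x s%:E) = 0%E.
    apply/eqP; rewrite eq_le measure_ge0 andbT -Qout dhE.
    apply: le_measure; rewrite ?inE//.
    by apply: subsetC => w; rewrite /ecball /= !lee_fin => /le_trans; exact.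
  by rewrite (muQ _ mC) Q0 mule0.
rewrite [leRHS](uniform_probE h0 mX) probability_setC//.
set p := P (ecball x s%:E).
have pE : p = (fine p)%:E by rewrite fineK// fin_num_measure.
have muE : mu (ecball x s%:E) = (h^-1 * fine p)%:E.
  rewrite muQ// EFinM -pE Qin// => w; rewrite /ecball /eball /= dhE lee_fin lte_fin.
  by move=> /le_lt_trans; exact.
apply: (@le_trans _ _ (h^-1%:E * @lebesgue_measure R (`]fine p, h]))%E); last first.
  rewrite lee_wpmul2l ?lee_fin ?invr_ge0 ?(ltW h0)//; apply: le_measure; rewrite ?inE//.
    exact: measurableI.
  move=> l /=; rewrite !in_itv /= => /andP[pl lh]; split; last first.
    have p0 : 0 <= fine p by rewrite fine_ge0// measure_ge0.
    by rewrite lh andbT (le_trans p0)// ltW.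
  rewrite rs ltr_pXn2r// ?nnegrE ?clipped_delta_ge0//.
  rewrite -lte_fin clipped_deltaE (min_idPl lh) ltNge; apply/negP => /le_mass_delta.
  by rewrite -/p pE lee_fin leNgt pl.
rewrite lebesgue_measure_itv /= lte_fin muE -EFinB.
case: ifPn => ph; last first.
  rewrite mule0 lee_fin subr_le0 ler_pdivlMl// mulr1 leNgt//.
by rewrite -EFinB -EFinM lee_fin mulrBr mulVf ?gt_eqF.
Qed.

End Uniform.

End DtmSecondMoment.

Lemma sqr_distD (R : realType) d (w x m : 'rV[R]_d) :
  enorm (w - x) ^+ 2 = (enorm (w - m) ^+ 2 + \sum_(i < d) 2 * (m 0 i - x 0 i) * w 0 i)
    + \sum_(i < d) (x 0 i ^+ 2 - m 0 i ^+ 2).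
Proof.
by rewrite !sqr_enorm -!big_split /=; apply: eq_bigr => i _; rewrite !mxE; ring.
Qed.

Section BoundedSupport.
Variables (R : realType) (d : nat).
Variables (mu : probability (eucl R d) R) (K : R).
Hypothesis muK : mu (~` eball 0 K%:E) = 0%E.

Lemma ae_enorm_lt : {ae mu, forall w : eucl R d, enorm (w : 'rV[R]_d) < K}.
Proof.
exists (~` eball 0 K%:E); split => //.
  by apply: measurableC; exact: measurable_eball.
by move=> w; apply: contra_not; rewrite /eball /= subr0 lte_fin.
Qed.

Lemma bounded_integrable (f : eucl R d -> R) (M : R) :
  measurable_fun setT f -> (forall w : 'rV[R]_d, enorm w < K -> `|f w| <= M) ->
  mu.-integrable setT (EFin \o f).
Proof.
move=> mf fM; apply/integrableP; split; first exact/measurable_EFinP.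
apply: (@le_lt_trans _ _ (`|M|%:E * mu setT)%E); last first.
  by rewrite probability_setT mule1 ltry.
apply: integral_le_bound => //; first exact/measurable_EFinP.
apply: filterS ae_enorm_lt => w wK _ /=.
by rewrite lee_fin (le_trans (fM w wK))// ler_norm.
Qed.

Lemma integrable_coord (i : 'I_d) :
  mu.-integrable setT (EFin \o (fun w : eucl R d => (w : 'rV[R]_d) 0 i)).
Proof.
apply: (@bounded_integrable _ K); first exact: measurable_coord.
move=> w wK; rewrite (le_trans _ (ltW wK))// (le_trans _ (norm_le_enorm _))//.
exact: ler_mx_entry.
Qed.

Lemma measurable_sqr_dist (x : 'rV[R]_d) :
  measurable_fun setT (fun w : eucl R d => enorm ((w : 'rV[R]_d) - x) ^+ 2).
Proof.
apply: measurable_funX; apply: continuous_measurable_eucl; exact: enorm_sub_continuous.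
Qed.

Lemma sqr_dist_le (x w : 'rV[R]_d) : enorm w < K -> enorm (w - x) ^+ 2 <= (K + enorm x) ^+ 2.
Proof.
move=> wK; have K0 : 0 <= K by rewrite (le_trans (enorm_ge0 w))// ltW.
rewrite ler_pXn2r// ?nnegrE ?addr_ge0 ?enorm_ge0//.
have := ler_enormB 0 w x; rewrite subr0 sub0r enormN; lra.
Qed.

Lemma integrable_sqr_dist (x : 'rV[R]_d) :
  mu.-integrable setT (EFin \o (fun w : eucl R d => enorm ((w : 'rV[R]_d) - x) ^+ 2)).
Proof.
apply: (@bounded_integrable _ ((K + enorm x) ^+ 2)); first exact: measurable_sqr_dist.
by move=> w wK; rewrite ger0_norm ?sqr_ge0// sqr_dist_le.
Qed.

Lemma second_momentE (x : 'rV[R]_d) :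
  second_moment mu x =
  (Rintegral mu setT (fun w : eucl R d => enorm ((w : 'rV[R]_d) - x) ^+ 2))%:E.
Proof. by rewrite fineK//; apply: integrable_fin_num => //; exact: integrable_sqr_dist. Qed.

Lemma bias_variance (x : 'rV[R]_d) :
  second_moment mu x = (enorm (x - mean mu) ^+ 2 + mean_sq_dev mu)%:E.
Proof.
rewrite second_momentE; congr EFin.
pose m := mean mu.
pose c i := 2 * (m 0 i - x 0 i).
pose e := \sum_(i < d) (x 0 i ^+ 2 - m 0 i ^+ 2).
have Ef (w : eucl R d) : enorm ((w : 'rV[R]_d) - x) ^+ 2 =
    (enorm ((w : 'rV[R]_d) - m) ^+ 2 + \sum_(i < d) c i * (w : 'rV[R]_d) 0 i) + e.
  exact: sqr_distD.
have ic i : mu.-integrable setT (EFin \o (fun w : eucl R d => c i * (w : 'rV[R]_d) 0 i)).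
  exact: (integrableZl _ (c i) (integrable_coord i)).
have iS : mu.-integrable setT (EFin \o (fun w : eucl R d => \sum_(i < d) c i * (w : 'rV[R]_d) 0 i)).
  rewrite (_ : EFin \o _ = (fun w : eucl R d => \sum_(i < d) (c i * (w : 'rV[R]_d) 0 i)%:E)%E).
    by apply: integrable_sum => // i _; exact: ic.
  by apply/funext => w; rewrite /= sumEFin.
have iE : mu.-integrable setT (EFin \o (cst e : eucl R d -> R)).
  exact: finite_measure_integrable_cst.
have im := integrable_sqr_dist m.
rewrite /Rintegral; under eq_integral do rewrite Ef.
rewrite -/(Rintegral _ _ _) RintegralD//; last exact: (integrableD _ im iS).
have mu1 : fine (mu setT) = 1 by rewrite probability_setT.
rewrite RintegralD// Rintegral_cst// [X in e * X]mu1 mulr1.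
have -> : (\int[mu]_w (\sum_(i < d) c i * (w : 'rV[R]_d) 0 i))%R = \sum_(i < d) c i * m 0 i.
  have Ei i : (\int[mu]_w (c i * (w : 'rV[R]_d) 0%R i)%:E = (c i * m 0%R i)%:E)%E.
    rewrite -[LHS]fineK; last by apply: integrable_fin_num => //; exact: ic.
    congr EFin; rewrite -/(Rintegral _ _ _) RintegralZl//; last exact: integrable_coord.
    by rewrite !mxE.
  rewrite /Rintegral; under eq_integral do rewrite -sumEFin.
  by rewrite integral_sum// (eq_bigr _ (fun i _ => Ei i)) sumEFin.
rewrite -addrA [RHS]addrC; congr (_ + _).
(* Integration has replaced w by the mean m in the affine part; the result is the same identity
   taken at w = m. *)
rewrite -/m enormB (sqr_distD m x m) subrr enorm0 expr0n add0r.
by congr (_ + _).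
Qed.

End BoundedSupport.

(** * Local measures *)

Section LocalMeasures.
Variables (R : realType) (d : nat).
Implicit Types (P mu : probability (eucl R d) R) (x t u : 'rV[R]_d) (h l s r K : R).

(** Continuity from below along closed balls of radius r - 1 / (n + 1): mass above h would make
    [delta] smaller than r. Those of negative radius are empty, hence the need for h >= 0. *)
Lemma measure_eball_delta P h x r : 0 <= h -> delta P h x = r%:E -> (P (eball x r%:E) <= h%:E)%E.
Proof.
move=> h0 dr.
have E : eball x r%:E = \bigcup_n ecball x (r - n.+1%:R^-1)%:E.
  apply/seteqP; split => w; rewrite /ecball /eball /= ?lte_fin.
    rewrite -subr_gt0 => wr; near \oo => n; exists n => //=.
    rewrite lee_fin lerBrDr -lerBrDl ltW//.
    by near: n; apply: near_infty_natSinv_lt (PosNum wr).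
  by move=> [n _] /=; rewrite lee_fin => /le_lt_trans; apply; rewrite ltrBlDr ltrDl.
have mE n : measurable (ecball x (r - n.+1%:R^-1)%:E : set (eucl R d)).
  exact: measurable_ecball.
have cv := @nondecreasing_cvg_mu _ _ _ P (fun n => ecball x (r - n.+1%:R^-1)%:E)
  mE (bigcupT_measurable _ mE).
rewrite -E in cv.
have {}cv : P (ecball x (r - n.+1%:R^-1)%:E) @[n --> \oo] --> P (eball x r%:E).
  apply: cv => m n mn; apply/subsetPset => w; rewrite /ecball /= !lee_fin.
  by move=> /le_trans; apply; rewrite lerD2l lerN2 lef_pV2 ?posrE// ler_nat ltnS.
rewrite -(cvg_lim (@ereal_hausdorff R) cv); apply: lime_le.
  by apply/cvg_ex; eexists; exact: cv.
apply: nearW => n; have [s0|s0] := leP 0 (r - n.+1%:R^-1); last first.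
  rewrite [X in P X](_ : _ = set0); last first.
    apply/seteqP; split => // w; rewrite /ecball /= lee_fin => /le_lt_trans /(_ s0).
    by rewrite ltNge enorm_ge0.
  by rewrite measure0 lee_fin.
rewrite leNgt; apply/negP => /(delta_le s0).
by rewrite dr lee_fin leNgt ltrBlDr ltrDl invr_gt0 ltr0n.
Unshelve. all: by end_near.
Qed.

(** Take P on the open ball plus a fraction [al] of P on its bounding sphere. The open ball has mass
    at most h and the closed one at least h, so [al] is in [0, 1]. *)
Lemma exists_local_measure P K h x : P (~` eball 0 K%:E) = 0%E -> 0 < h -> h < 1 ->
  exists mu, local_measure P h (FinitePoint x) mu.
Proof.
move=> PK h0 h1.
set r := fine (delta P h x).
have dr : delta P h x = r%:E by rewrite /r fineK// (delta_fin_num _ PK).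
have mB := measurable_eball x r.
have mBc := measurable_ecball x r.
have mS : measurable (ecball x r%:E `\` eball x r%:E : set (eucl R d)) by exact: measurableD.
set B := eball x r%:E in mB mS *; set S := _ `\` B in mS *.
have BBc : B `<=` ecball x r%:E by move=> w; rewrite /B /eball /ecball /= lte_fin lee_fin => /ltW.
have PBh : (P B <= h%:E)%E by apply: measure_eball_delta => //; exact: ltW.
have hPBc : (h%:E <= P (ecball x r%:E))%E by apply: le_mass_delta; rewrite dr.
have PE : P (ecball x r%:E) = (P B + P S)%E.
  rewrite -measureU//; last by apply/seteqP; split => // w [wB [_ nB]].
  congr (P _); apply/seteqP; split => w; last by move=> [/BBc|[]].
  by move=> wB; have [|nB] := pselect (B w); [left|right].
have EB : P B = (fine (P B))%:E by rewrite fineK// fin_num_measure.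
have ES : P S = (fine (P S))%:E by rewrite fineK// fin_num_measure.
set pB := fine (P B) in EB; set pS := fine (P S) in ES.
rewrite PE EB ES -EFinD lee_fin in hPBc.
rewrite EB lee_fin in PBh.
have pS0 : 0 <= pS by rewrite /pS fine_ge0// measure_ge0.
(* If the sphere is null, division by 0 gives [al] = 0, which is right since then pB = h. *)
pose al := (h - pB) / pS.
have al0 : 0 <= al by rewrite divr_ge0// subr_ge0.
have alS : al * pS = h - pB.
  have [pS00|pSn0] := eqVneq pS 0; last by rewrite /al divfK.
  by rewrite pS00 mulr0; lra.
have al1 : al <= 1.
  have [pS00|pSn0] := eqVneq pS 0; first by rewrite /al pS00 invr0 mulr0.
  by rewrite /al ler_pdivrMr ?lt0r ?pSn0// mul1r; lra.
pose Q : {measure set (eucl R d) -> \bar R} :=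
  measure_add (mrestr P mB) (mscale (NngNum al0) (mrestr P mS)).
have QE A : Q A = (P (A `&` B) + al%:E * P (A `&` S))%E by exact: measure_addE.
have QT : Q setT = h%:E.
  by rewrite QE !setTI EB ES -EFinM alS -EFinD; congr EFin; ring.
have muE A : mnormalize Q P A = (h^-1%:E * Q A)%E.
  rewrite /mnormalize QT eqe (gt_eqF h0) orFb (_ : (h%:E == +oo%E) = false)//; exact: muleC.
exists (mnormalize Q P : probability (eucl R d) R); exists Q; split => //.
- move=> A mA; rewrite QE.
  have mAB : measurable (A `&` B) by exact: measurableI.
  have mAS : measurable (A `&` S) by exact: measurableI.
  apply: (@le_trans _ _ (P (A `&` B) + P (A `&` S))%E).
    by rewrite leeD2l// -[leRHS]mul1e lee_wpmul2r// lee_fin.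
  rewrite -measureU//; last first.
    by apply/seteqP; split => // w [[_ wB] [_ [_ nB]]].
  apply: le_measure; rewrite ?inE//; first exact: measurableU.
  by move=> w [[]|[]].
- move=> A mA; rewrite /= dr -/B => AB; rewrite QE (setIidl AB).
  have -> : A `&` S = set0 by apply/seteqP; split => // w [/AB wB [_ nB]].
  by rewrite measure0 mule0 adde0.
- rewrite QE /= dr.
  have -> : ~` ecball x r%:E `&` B = set0 by apply/seteqP; split => // w [nw /BBc].
  have -> : ~` ecball x r%:E `&` S = set0 by apply/seteqP; split => // w [nw []].
  by rewrite !measure0 mule0 adde0.
- by move=> A _; exact: muE.
Qed.

Lemma delta_lipschitz P h t u r : delta P h t = r%:E ->
  (delta P h u <= (r + enorm (u - t))%:E)%E.
Proof.
move=> dr; have r0 : 0 <= r by rewrite -lee_fin -dr delta_ge0.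
apply/lee_addgt0Pr => e e0; rewrite -EFinD.
apply: delta_le; first by rewrite !addr_ge0 ?enorm_ge0// ltW.
have : (h%:E < P (ecball t (r + e)%:E))%E.
  by apply: delta_lt; rewrite dr lte_fin ltrDl.
move=> /lt_le_trans; apply; apply: le_measure; rewrite ?inE; try exact: measurable_ecball.
move=> w; rewrite /ecball /= !lee_fin => wt.
have := ler_enormB t w u; rewrite (enormB t u); lra.
Qed.

Lemma norm_Rintegral_le mu (D : set (eucl R d)) (f : eucl R d -> R) (M : R) :
  measurable D -> measurable_fun setT f -> 0 <= M ->
  {ae mu, forall w, D w -> `|f w| <= M} ->
  `|Rintegral mu D f| <= M * fine (mu D).
Proof.
move=> mD mf M0 fM.
have mf' : measurable_fun D (EFin \o f).
  by apply/measurable_EFinP; exact: measurable_funS mf.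
have H : (\int[mu]_(w in D) `|(f w)%:E| <= M%:E * mu D)%E.
  exact: integral_le_bound.
have H2 : (`|\int[mu]_(w in D) (f w)%:E| <= M%:E * mu D)%E.
  by apply: le_trans H; exact: le_abse_integral.
have muD : mu D = (fine (mu D))%:E by rewrite fineK// fin_num_measure.
rewrite muD -EFinM in H2.
have fin : (\int[mu]_(w in D) (f w)%:E)%E \is a fin_num.
  by rewrite fin_num_abs (le_lt_trans H2)// ltry.
by move: H2; rewrite -{1}(fineK fin) /= lee_fin.
Qed.

End LocalMeasures.

(** * Comparison of the local measures at two centres *)

Section Comparison.
Variables (R : realType) (d : nat).
Implicit Types (P mu : probability (eucl R d) R) (x t u : 'rV[R]_d) (h l s r K : R).

Lemma norm_dotp_le (x y : 'rV[R]_d) : `|dotp x y| <= enorm x * enorm y.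
Proof.
rewrite ler_norml dotp_le andbT lerNl -(enormN x) (le_trans _ (dotp_le _ _))//.
by rewrite /dotp -sumrN; apply: ler_sum => i _; rewrite mxE mulNr.
Qed.

Lemma submeasure_null P h mu (A : set (eucl R d)) : 0 < h -> submeasure P h mu ->
  measurable A -> P A = 0%E -> mu A = 0%E.
Proof.
move=> h0 muP mA PA; have := muP _ mA; rewrite PA => H.
apply/eqP; rewrite eq_le measure_ge0 andbT.
by rewrite -(@lee_pmul2l _ h%:E)// mule0.
Qed.

(* |w - u|^2 = |w - t|^2 + cross t u w + |t - u|^2 *)
Definition cross t u (w : eucl R d) : R := 2 * dotp ((w : 'rV[R]_d) - t) (t - u).

Lemma norm_cross_le t u w : `|cross t u w| <= 2 * enorm (u - t) * enorm ((w : 'rV[R]_d) - t).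
Proof.
rewrite /cross normrM ger0_norm// -mulrA ler_wpM2l// (le_trans (norm_dotp_le _ _))//.
by rewrite mulrC (enormB u).
Qed.

Lemma measurable_cross t u : measurable_fun setT (cross t u).
Proof.
rewrite (_ : cross t u = fun w : eucl R d =>
   enorm ((w : 'rV[R]_d) - u) ^+ 2 - enorm ((w : 'rV[R]_d) - t) ^+ 2 - enorm (t - u) ^+ 2).
  by apply: measurable_funB => //; apply: measurable_funB => //; exact: measurable_sqr_dist.
apply/funext => w.
by rewrite -[(w : 'rV[R]_d) - u](subrKA t) (enormD2 (w - t : 'rV[R]_d)) /cross; ring.
Qed.

Variables (P : probability (eucl R d) R) (K h : R).
Hypotheses (PK : P (~` eball 0 K%:E) = 0%E) (h0 : 0 < h) (h1 : h < 1).

Lemma submeasure_carried mu : submeasure P h mu -> mu (~` eball 0 K%:E) = 0%E.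
Proof.
move=> muP; apply: (submeasure_null h0 muP _ PK).
by apply: measurableC; exact: measurable_eball.
Qed.

Lemma integrable_cross mu t u : submeasure P h mu -> mu.-integrable setT (EFin \o cross t u).
Proof.
move=> /submeasure_carried muK.
apply: (bounded_integrable muK (M := 2 * enorm (u - t) * (K + enorm t))).
  exact: measurable_cross.
move=> w wK; rewrite (le_trans (norm_cross_le _ _ _))// ler_wpM2l ?mulr_ge0 ?enorm_ge0//.
have := ler_enormB 0 w t; rewrite subr0 sub0r enormN; lra.
Qed.

Lemma second_moment_shift mu t u : submeasure P h mu ->
  second_moment mu u =
  (second_moment mu t + (Rintegral mu setT (cross t u) + enorm (t - u) ^+ 2)%:E)%E.
Proof.
move=> muP; have muK := submeasure_carried muP.
rewrite !(second_momentE muK) -EFinD; congr EFin.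
have it := integrable_sqr_dist muK t.
have ic := integrable_cross t u muP.
have iE : mu.-integrable setT (EFin \o (cst (enorm (t - u) ^+ 2) : eucl R d -> R)).
  exact: finite_measure_integrable_cst.
have mu1 : fine (mu setT) = 1 by rewrite probability_setT.
have Ef (w : eucl R d) : enorm ((w : 'rV[R]_d) - u) ^+ 2 =
    (enorm ((w : 'rV[R]_d) - t) ^+ 2 + cross t u w) + enorm (t - u) ^+ 2.
  by rewrite -[(w : 'rV[R]_d) - u](subrKA t) (enormD2 (w - t : 'rV[R]_d)) /cross; ring.
rewrite {1}/Rintegral; under eq_integral do rewrite Ef.
rewrite -/(Rintegral _ _ _) RintegralD//; last exact: (integrableD _ it ic).
by rewrite RintegralD// Rintegral_cst// [X in _ * X]mu1 mulr1 addrA.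
Qed.

(* The remaining terms cancel: mut minimizes the second moment about t. *)
Lemma second_moment_gap t u mut muu :
  local_measure P h (FinitePoint t) mut -> local_measure P h (FinitePoint u) muu ->
  (second_moment mut u <= dtm P h u ^+ 2 +
    (Rintegral mut setT (cross t u) - Rintegral muu setT (cross t u))%:E)%E.
Proof.
move=> Lt Lu.
have St := local_measure_submeasure h0 Lt; have Su := local_measure_submeasure h0 Lu.
have H1 : (second_moment mut t <= second_moment muu t)%E.
  apply: le_trans (local_measure_second_moment_le PK h0 h1 Lt) _.
  exact: (dtm_sqr_le PK h0 h1).
have H2 := local_measure_second_moment_le PK h0 h1 Lu.
have Ht := second_moment_shift t u St; have Hu := second_moment_shift t u Su.
apply: (@le_trans _ _ (second_moment muu u +
    (Rintegral mut setT (cross t u) - Rintegral muu setT (cross t u))%:E)%E).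
  rewrite Ht Hu; move: H1; rewrite !(second_momentE (submeasure_carried _))//.
  by rewrite -!EFinD !lee_fin; lra.
by rewrite leeD2r.
Qed.

Lemma local_measure_ae_le t mu r : local_measure P h (FinitePoint t) mu ->
  delta P h t = r%:E -> {ae mu, forall w : eucl R d, enorm ((w : 'rV[R]_d) - t) <= r}.
Proof.
move=> [Q [_ _ _ Q0 muQ]] dr; rewrite /= dr in Q0.
have mC : measurable (~` ecball t r%:E : set (eucl R d)).
  by apply: measurableC; exact: measurable_ecball.
exists (~` ecball t r%:E); split => //; first by rewrite muQ// Q0 mule0.
Qed.

(** [mut] lives within r of t, and [muu] within r + 2 e of t: its radius is at most r + e and its
    centre is at distance e. The bound is of order e^2 once r is at most a multiple of e. *)
Lemma cross_gap_far t u mut muu r :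
  local_measure P h (FinitePoint t) mut -> local_measure P h (FinitePoint u) muu ->
  delta P h t = r%:E ->
  Rintegral mut setT (cross t u) - Rintegral muu setT (cross t u) <=
  2 * enorm (u - t) * (2 * r + 2 * enorm (u - t)).
Proof.
move=> Lt Lu dr; set e := enorm (u - t).
have e0 : 0 <= e by exact: enorm_ge0.
have r0 : 0 <= r by rewrite -lee_fin -dr delta_ge0.
have dle : (delta P h u <= (r + e)%:E)%E by exact: delta_lipschitz.
have dru : delta P h u = (fine (delta P h u))%:E by rewrite fineK// (delta_fin_num _ PK).
have rue : fine (delta P h u) <= r + e by rewrite -lee_fin -dru.
have H (mu : probability (eucl R d) R) (M : R) : 0 <= M ->
  {ae mu, forall w : eucl R d, enorm ((w : 'rV[R]_d) - t) <= M} ->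
  `|Rintegral mu setT (cross t u)| <= 2 * e * M.
  move=> M0 ae.
  have mu1 : fine (mu setT) = 1 by rewrite probability_setT.
  rewrite -[leRHS]mulr1 -[X in _ * M * X]mu1; apply: norm_Rintegral_le => //.
  - exact: measurable_cross.
  - by rewrite !mulr_ge0.
  - apply: filterS ae => w wM _; rewrite (le_trans (norm_cross_le _ _ _))//.
    by rewrite ler_wpM2l// mulr_ge0.
have Ht : `|Rintegral mut setT (cross t u)| <= 2 * e * r.
  by apply: H => //; exact: local_measure_ae_le Lt dr.
have Hu : `|Rintegral muu setT (cross t u)| <= 2 * e * (r + 2 * e).
  apply: H; first by rewrite addr_ge0// mulr_ge0.
  apply: filterS (local_measure_ae_le Lu dru) => w wu.
  have := ler_enormB u w t; rewrite -/e; lra.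
move: Ht Hu; rewrite !ler_norml => /andP[_ h2] /andP[h3 _]; lra.
Qed.

(** The margin 2 e adds the shift e of the centre and a change of radius of at most e: both measures
    are P / h inside the annulus and vanish beyond it, so the integrals cancel there. On the
    annulus, [cross] is at most 2 e (r + 2 e) and each measure at most P / h; two such terms give
    the factor 4. *)
Lemma cross_gap_near t u mut muu r :
  local_measure P h (FinitePoint t) mut -> local_measure P h (FinitePoint u) muu ->
  delta P h t = r%:E ->
  Rintegral mut setT (cross t u) - Rintegral muu setT (cross t u) <=
  4 * enorm (u - t) * (r + 2 * enorm (u - t)) *
   (h^-1 * fine (P (annulus t (r - 2 * enorm (u - t)) (r + 2 * enorm (u - t))))).
Proof.
move=> Lt Lu dr; set e := enorm (u - t); set S := annulus _ _ _.
have e0 : 0 <= e by exact: enorm_ge0.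
have r0 : 0 <= r by rewrite -lee_fin -dr delta_ge0.
have mS : measurable (S : set (eucl R d)) by exact: measurable_annulus.
have mCS : measurable (~` S : set (eucl R d)) by exact: measurableC.
have dle : (delta P h u <= (r + e)%:E)%E by exact: delta_lipschitz.
have dru : delta P h u = (fine (delta P h u))%:E by rewrite fineK// (delta_fin_num _ PK).
set ru := fine (delta P h u) in dru.
have rue : ru <= r + e by rewrite -lee_fin -dru.
have rle : r <= ru + e.
  by rewrite -lee_fin -dr /e enormB; exact: delta_lipschitz.
have St := local_measure_submeasure h0 Lt; have Su := local_measure_submeasure h0 Lu.
have split_int mu : submeasure P h mu -> Rintegral mu setT (cross t u) =
    Rintegral mu S (cross t u) + Rintegral mu (~` S) (cross t u).
  move=> muP; rewrite -Rintegral_setU//.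
  - by rewrite setUCr.
  - by rewrite setUCr; exact: integrable_cross.
  - by apply/disj_setPCl.
have EQ : Rintegral mut (~` S) (cross t u) = Rintegral muu (~` S) (cross t u).
  congr fine; apply: eq_measure_integral => A mA AS.
  have m1 : measurable (eball t (r - 2 * e)%:E : set (eucl R d)) by exact: measurable_eball.
  have m2 : measurable (~` ecball t (r + 2 * e)%:E : set (eucl R d)).
    by apply: measurableC; exact: measurable_ecball.
  have mA1 : measurable (A `&` eball t (r - 2 * e)%:E : set (eucl R d)) by exact: measurableI.
  have mA2 : measurable (A `&` ~` ecball t (r + 2 * e)%:E : set (eucl R d)) by exact: measurableI.
  have AE : A = (A `&` eball t (r - 2 * e)%:E) `|` (A `&` ~` ecball t (r + 2 * e)%:E).
    apply/seteqP; split => w; last by move=> [[]|[]].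
    move=> Aw; have := AS _ Aw; rewrite /S /annulus /eball /ecball /= => /negP.
    rewrite negb_and -!ltNge => /orP[h'|h']; [left|right].
      by split => //=; rewrite lte_fin.
    by split => //=; rewrite lee_fin; apply/negP; rewrite -ltNge.
  have A12 : (A `&` eball t (r - 2 * e)%:E) `&` (A `&` ~` ecball t (r + 2 * e)%:E) = set0.
    apply/seteqP; split => // w [[_]]; rewrite /eball /ecball /= lte_fin => h' [_].
    by rewrite lee_fin; apply; lra.
  have [Qt [_ _ Qt1 Qt0 muQt]] := Lt; have [Qu [_ _ Qu1 Qu0 muQu]] := Lu.
  rewrite /= dr in Qt1 Qt0; rewrite /= dru in Qu1 Qu0.
  have E1 : mut (A `&` eball t (r - 2 * e)%:E) = muu (A `&` eball t (r - 2 * e)%:E).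
    rewrite muQt// muQu// Qt1// ?Qu1//.
      move=> w [_]; rewrite /eball /= !lte_fin => h'.
      have := ler_enormB t w u; rewrite (enormB t) -/e; lra.
    by move=> w [_]; rewrite /eball /= !lte_fin => h'; lra.
  have Z (Q : {measure set (eucl R d) -> \bar R}) (B C : set (eucl R d)) :
      measurable B -> measurable C -> B `<=` C -> Q C = 0%E -> Q B = 0%E.
    move=> mB mC BC QC; apply/eqP; rewrite eq_le measure_ge0 andbT -QC.
    by apply: le_measure; rewrite ?inE.
  have Zt : Qt (A `&` ~` ecball t (r + 2 * e)%:E) = 0%E.
    apply: Z Qt0 => //; first by apply: measurableC; exact: measurable_ecball.
    move=> w [_]; rewrite /ecball /= !lee_fin => /negP; rewrite -ltNge => h'.
    by apply/negP; rewrite -ltNge; lra.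
  have Zu : Qu (A `&` ~` ecball t (r + 2 * e)%:E) = 0%E.
    apply: Z Qu0 => //; first by apply: measurableC; exact: measurable_ecball.
    move=> w [_]; rewrite /ecball /= !lee_fin => /negP; rewrite -ltNge => h'.
    by apply/negP; rewrite -ltNge; have := ler_enormB u w t; rewrite -/e; lra.
  have E2 : mut (A `&` ~` ecball t (r + 2 * e)%:E) = muu (A `&` ~` ecball t (r + 2 * e)%:E).
    by rewrite muQt// muQu// Zt Zu.
  by rewrite AE !measureU//; congr (_ + _)%E; [exact: E1|exact: E2].
have H mu : submeasure P h mu ->
   `|Rintegral mu S (cross t u)| <= 2 * e * (r + 2 * e) * (h^-1 * fine (P S)).
  move=> muP.
  apply: (@le_trans _ _ (2 * e * (r + 2 * e) * fine (mu S))).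
    apply: norm_Rintegral_le => //.
    - exact: measurable_cross.
    - by rewrite !mulr_ge0// addr_ge0// mulr_ge0.
    - apply: aeW => w /andP[_ wS]; rewrite (le_trans (norm_cross_le _ _ _))//.
      by rewrite ler_wpM2l// mulr_ge0.
  rewrite ler_wpM2l//; first by rewrite !mulr_ge0// addr_ge0// mulr_ge0.
  rewrite ler_pdivlMl// -lee_fin EFinM !fineK ?fin_num_measure//.
  exact: muP.
rewrite (split_int _ St) (split_int _ Su) EQ.
have := H _ St; have := H _ Su; rewrite !ler_norml => /andP[h3 _] /andP[_ h2]; lra.
Qed.

End Comparison.

(** * Nets and the quadratic bound *)

Section Covering.
Variables (R : realType) (d : nat).

(** Balls of radius eps / 2 about eps-separated points are disjoint and each has mass at least 1 /
    k, which bounds their number by k. A point far from a maximal family could be appended to it. *)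
Lemma finite_net (P : probability (eucl R d) R) (N : set 'rV[R]_d) (x0 : 'rV[R]_d)
    (k : nat) (eps : R) :
  N x0 -> (0 < k)%N -> (forall x, N x -> (k%:R^-1%:E <= P (eball x (eps / 2)%:E))%E) ->
  exists t : 'I_k -> 'rV[R]_d, (forall i, N (t i)) /\
    forall u, N u -> exists i, enorm (u - t i) < eps.
Proof.
move=> Nx0 k0 NP.
pose sep M := exists f : nat -> 'rV[R]_d, (forall i, (i < M)%N -> N (f i)) /\
  forall i j, (i < j)%N -> (j < M)%N -> eps <= enorm (f i - f j).
have sepk M : sep M -> (M <= k)%N.
  move=> [f [Nf sf]].
  have : (M%:R%:E * k%:R^-1%:E <= P setT)%E.
    apply: (@mul_le_measure _ (eucl R d) R P M (fun i : 'I_M => eball (f i) (eps / 2)%:E)) => //;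
      last by move=> i; apply: NP; exact: Nf.
    - by move=> i; exact: measurable_eball.
    - have aux (i j : 'I_M) w : (i < j)%N -> eball (f i) (eps / 2)%:E w ->
        eball (f j) (eps / 2)%:E w -> False.
        move=> ij; rewrite /eball /= !lte_fin => wi wj.
        have := sf i j ij (ltn_ord j); have := ler_enormB w (f i) (f j).
        rewrite (enormB (f i) w); lra.
      apply/trivIsetP => i j _ _ ij; apply/seteqP; split => // w [wi wj].
      move: ij; rewrite -val_eqE neq_ltn => /orP[] ij.
        exact: (aux i j w).
      exact: (aux j i w).
  have PT := probability_setT P.
  by rewrite PT -EFinM lee_fin ler_pdivrMr ?ltr0n// mul1r ler_nat.
pose sepb M := `[< sep M >].
have ex0 : exists M, sepb M by exists 0%N; apply/asboolP; exists (fun=> x0); split.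
have ub M : sepb M -> (M <= k)%N by move=> /asboolP; exact: sepk.
have [M /asboolP[f [Nf sf]] Mmax] := ex_maxnP ex0 ub.
have Mk : (M <= k)%N by apply: sepk; exists f.
(* The family may have fewer than k points; [x0] pads it. *)
exists (fun i : 'I_k => if (i < M)%N then f i else x0); split.
  by move=> i; case: ifPn => // iM; exact: Nf.
move=> u Nu; apply: contrapT => no.
have far i : (i < M)%N -> eps <= enorm (f i - u).
  move=> iM; rewrite leNgt; apply/negP => h; apply: no.
  by exists (Ordinal (leq_trans iM Mk)); rewrite /= iM enormB.
have /Mmax : sepb M.+1.
  apply/asboolP; exists (fun i => if (i < M)%N then f i else u); split.
    by move=> i _; case: ifPn => // iM; exact: Nf.
  move=> i j ij; rewrite ltnS leq_eqVlt => /orP[/eqP jM|jM].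
    by rewrite -jM ij ltnn; apply: far; rewrite -jM.
  by rewrite jM (ltn_trans ij jM); exact: sf.
by rewrite ltnn.
Qed.

End Covering.

Section QuadraticBound.
Variables (R : realType) (d n : nat).
Variables (P : probability (eucl R d) R) (K h : R).
Hypotheses (PK : P (~` eball 0 K%:E) = 0%E) (h0 : 0 < h) (h1 : h < 1).

(** The open ball of radius [delta] has mass at most h < 1, so the minimum cannot be 1. *)
Lemma delta_pow_le (t : 'rV[R]_d) (r c0 : R) : (0 < n)%N -> 0 < c0 -> delta P h t = r%:E ->
  (forall s, 0 < s -> ((Num.min (c0 * s ^+ n) 1)%:E <= P (eball t s%:E))%E) ->
  c0 * r ^+ n <= h.
Proof.
move=> n0 c00 dr Hs.
have : 0 <= r by rewrite -lee_fin -dr delta_ge0.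
rewrite le_eqVlt => /orP[/eqP<-|r0]; first by rewrite expr0n gtn_eqF// mulr0 ltW.
have := le_trans (Hs _ r0) (measure_eball_delta (ltW h0) dr).
by rewrite lee_fin ge_min => /orP[//|]; rewrite leNgt h1.
Qed.

Lemma second_moment_quadratic (t u : 'rV[R]_d) mut muu (r r0 Ca c0 : R) :
  local_measure P h (FinitePoint t) mut -> local_measure P h (FinitePoint u) muu ->
  delta P h t = r%:E -> 0 < c0 -> 0 <= Ca -> c0 * r ^+ n <= h -> 2 * r <= r0 ->
  (forall a b, 0 < a -> a < b -> b <= r0 ->
     (P (annulus t a b) <= (Ca * ((b - a) / a) * b ^+ n)%:E)%E) ->
  (second_moment mut u <= dtm P h u ^+ 2 +
     ((20 + 48 * Ca * (3 / 2) ^+ n / c0) * enorm (u - t) ^+ 2)%:E)%E.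
Proof.
move=> Lt Lu dr c00 Ca0 cr rr0 Hann.
apply: le_trans (second_moment_gap PK h0 h1 Lt Lu) _.
rewrite leeD2l// lee_fin.
set e := enorm (u - t).
have e0 : 0 <= e by exact: enorm_ge0.
have C0 : 0 <= 48 * Ca * (3 / 2) ^+ n / c0.
  by rewrite divr_ge0 ?(ltW c00)// !mulr_ge0// exprn_ge0.
have r00 : 0 <= r by rewrite -lee_fin -dr delta_ge0.
have Hfar := cross_gap_far PK h1 Lt Lu dr; rewrite -/e in Hfar.
(* With r <= 4 e, 2 e (2 r + 2 e) <= 20 e^2: this is the 20 of the constant. *)
have far_case : e = 0 \/ r <= 4 * e ->
    2 * e * (2 * r + 2 * e) <= (20 + 48 * Ca * (3 / 2) ^+ n / c0) * e ^+ 2.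
  move=> [->|re]; first by rewrite expr0n !mulr0 mul0r.
  have : 0 <= 48 * Ca * (3 / 2) ^+ n / c0 * e ^+ 2 by rewrite mulr_ge0// sqr_ge0.
  have : e * r <= e * (4 * e) by rewrite ler_wpM2l.
  by rewrite mulrDl; nra.
have [re|er] := leP r (4 * e); first by apply: le_trans Hfar _; apply: far_case; right.
(* For e = 0 the annulus degenerates and the bound for a < b does not apply; the crude estimate
   gives 0. *)
have [e00|en0] := eqVneq e 0; first by apply: le_trans Hfar _; apply: far_case; left.
have ep : 0 < e by rewrite lt0r en0.
have rp : 0 < r by lra.
apply: le_trans (cross_gap_near PK h0 h1 Lt Lu dr) _; rewrite -/e.
set p := fine _.
have a0 : 0 < r - 2 * e by lra.
have pE : p <= Ca * ((4 * e) / (r / 2)) * ((3 / 2) * r) ^+ n.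
  have := Hann (r - 2 * e) (r + 2 * e) a0 _ _.
  move=> /(_ ltac:(lra) ltac:(lra)) H.
  have pf : P (annulus t (r - 2 * e) (r + 2 * e)) = p%:E.
    by rewrite fineK// fin_num_measure//; exact: measurable_annulus.
  rewrite pf lee_fin in H; apply: le_trans H _.
  apply: ler_pM.
  - by rewrite mulr_ge0// divr_ge0//; lra.
  - by rewrite exprn_ge0//; lra.
  - rewrite ler_wpM2l// (_ : r + 2 * e - (r - 2 * e) = 4 * e); last by ring.
    by rewrite ler_wpM2l ?mulr_ge0// lef_pV2 ?posrE//; lra.
  - by rewrite lerXn2r ?nnegrE//; lra.
have hi0 : 0 < h^-1 by rewrite invr_gt0.
have p0 : 0 <= p by rewrite fine_ge0// measure_ge0.
apply: (@le_trans _ _ (4 * e * ((3 / 2) * r) *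
   (h^-1 * (Ca * ((4 * e) / (r / 2)) * ((3 / 2) * r) ^+ n)))).
  apply: ler_pM; first by rewrite !mulr_ge0//; lra.
  - by rewrite mulr_ge0// ltW.
  - by rewrite ler_wpM2l ?mulr_ge0//; lra.
  - by rewrite ler_wpM2l// ltW.
rewrite exprMn.
(* Since 4 e < r, the radii are between r / 2 and 3 r / 2 and differ by 4 e; 48 is 4 (3 / 2) 8. The
   factor r^n / h left over is at most 1 / c0, so the bound is uniform in h. *)
have -> : 4 * e * (3 / 2 * r) * (h^-1 * (Ca * (4 * e / (r / 2)) * ((3 / 2) ^+ n * r ^+ n))) =
   48 * Ca * (3 / 2) ^+ n * (h^-1 * r ^+ n) * e ^+ 2.
  by field; rewrite !gt_eqF.
apply: (@le_trans _ _ (48 * Ca * (3 / 2) ^+ n / c0 * e ^+ 2)); last first.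
  by rewrite ler_wpM2r ?sqr_ge0// lerDr.
rewrite ler_wpM2r ?sqr_ge0// ler_wpM2l//.
  by rewrite !mulr_ge0// exprn_ge0.
by rewrite ler_pdivrMl// ler_pdivlMr// mulrC.
Qed.

End QuadraticBound.

(** * Continuity of the distance to measure and comparison of criteria *)

Lemma fine_sub_le (R : realType) (a b : \bar R) (c : R) :
  a \is a fin_num -> b \is a fin_num -> (a <= b + c%:E)%E -> fine a - fine b <= c.
Proof.
by move: a b => [a||] [b||]// _ _; rewrite -EFinD lee_fin /= lerBlDl.
Qed.

Lemma continuous_locally_lipschitz (R : realType) d (F : 'rV[R]_d -> R) (K : R) :
  0 < K ->
  (forall u v, F u - F v <= enorm (u - v) * (2 * (K + enorm v) + enorm (u - v))) ->
  forall v : 'rV[R]_d, {for v, continuous F}.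
Proof.
move=> K0 HF v.
apply: (iffRL (@cvgrPdist_lt _ _ _ (nbhs v) _ _ _)) => eta eta0.
(* Bounds the second factor for both orders of u and v, since |u| <= |v| + 1 when |u - v| < 1. *)
pose M := 2 * (K + enorm v + 1) + 1.
have M0 : 0 < M by rewrite /M ltr_pwDr// mulr_ge0// !addr_ge0 ?enorm_ge0// ltW.
have near1 : \forall u \near v, enorm (u - v) < Num.min 1 (eta / M).
  apply: open_nbhs_nbhs; split; first exact: open_enorm_lt.
  by rewrite /= subrr enorm0 lt_min ltr01 divr_gt0.
apply: filterS near1 => u; rewrite lt_min ltr_pdivlMr// => /andP[u1 u2].
have e0 := enorm_ge0 (u - v).
have uv : enorm u <= enorm v + 1.
  by have := ler_enormB v u 0; rewrite !subr0; lra.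
have A1 := HF u v; have A2 := HF v u.
rewrite (enormB v u) in A2.
have B1 : enorm (u - v) * (2 * (K + enorm v) + enorm (u - v)) <= enorm (u - v) * M.
  by rewrite ler_wpM2l// /M; lra.
have B2 : enorm (u - v) * (2 * (K + enorm u) + enorm (u - v)) <= enorm (u - v) * M.
  by rewrite ler_wpM2l// /M; lra.
by rewrite ltr_norml; apply/andP; split; lra.
Qed.

Section DtmContinuity.
Variables (R : realType) (d : nat).
Variables (P : probability (eucl R d) R) (K h : R).
Hypotheses (PK : P (~` eball 0 K%:E) = 0%E) (h0 : 0 < h) (h1 : h < 1) (K0 : 0 < K).

Lemma second_moment_le (mu : probability (eucl R d) R) (u : 'rV[R]_d) :
  submeasure P h mu -> (second_moment mu u <= ((K + enorm u) ^+ 2)%:E)%E.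
Proof.
move=> /(submeasure_carried PK h0) muK.
rewrite (second_momentE muK) lee_fin (le_trans (ler_norm _))//.
have mu1 : fine (mu setT) = 1 by rewrite probability_setT.
rewrite -[leRHS]mulr1 -[X in _ ^+ 2 * X]mu1; apply: norm_Rintegral_le => //.
- exact: measurable_sqr_dist.
- exact: sqr_ge0.
- apply: filterS (ae_enorm_lt muK) => w wK _.
  by rewrite ger0_norm ?sqr_ge0// sqr_dist_le.
Qed.

Lemma dtm_sqr_fin_num (u : 'rV[R]_d) : (dtm P h u ^+ 2)%E \is a fin_num.
Proof.
have [mu Lu] := exists_local_measure u PK h0 h1.
have Su := local_measure_submeasure h0 Lu.
rewrite ge0_fin_numE ?sqre_ge0//.
apply: le_lt_trans (dtm_sqr_le PK h0 h1 u Su) _.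
by apply: le_lt_trans (second_moment_le u Su) _; rewrite ltry.
Qed.

(** A local measure at v is a competitor at u, and its second moment about u differs from the one
    about v by the cross term and |u - v|^2. *)
Lemma dtm_sqr_sub_le (u v : 'rV[R]_d) :
  fine (dtm P h u ^+ 2)%E - fine (dtm P h v ^+ 2)%E <=
    enorm (u - v) * (2 * (K + enorm v) + enorm (u - v)).
Proof.
have [mu Lv] := exists_local_measure v PK h0 h1.
have Sv := local_measure_submeasure h0 Lv.
have muK := submeasure_carried PK h0 Sv.
have H1 := dtm_sqr_le PK h0 h1 u Sv.
have H2 := local_measure_second_moment_le PK h0 h1 Lv.
have Hs := second_moment_shift PK h0 v u Sv.
have H3 : Rintegral mu setT (cross v u) <= 2 * enorm (u - v) * (K + enorm v).
  have mu1 : fine (mu setT) = 1 by rewrite probability_setT.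
  rewrite (le_trans (ler_norm _))// -[leRHS]mulr1 -[X in _ * (_ + _) * X]mu1.
  apply: norm_Rintegral_le => //.
  - exact: measurable_cross.
  - by rewrite !mulr_ge0 ?enorm_ge0// addr_ge0 ?enorm_ge0// ltW.
  - apply: filterS (ae_enorm_lt muK) => w wK _.
    rewrite (le_trans (norm_cross_le _ _ _))// ler_wpM2l ?mulr_ge0 ?enorm_ge0//.
    have := ler_enormB 0 w v; rewrite subr0 sub0r enormN; lra.
have H4 : (dtm P h u ^+ 2 <= dtm P h v ^+ 2 +
    (Rintegral mu setT (cross v u) + enorm (v - u) ^+ 2)%:E)%E.
  by apply: le_trans H1 _; rewrite Hs leeD2r.
apply: le_trans (fine_sub_le (dtm_sqr_fin_num u) (dtm_sqr_fin_num v) H4) _.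
by rewrite (enormB v u); lra.
Qed.

Lemma measurable_dtm_sqr : measurable_fun [set: eucl R d] (fun u : eucl R d => (dtm P h u ^+ 2)%E).
Proof.
rewrite (_ : (fun u => _) = EFin \o (fun u : eucl R d => fine (dtm P h u ^+ 2)%E)).
  apply/measurable_EFinP; apply: continuous_measurable_eucl => u.
  exact: (continuous_locally_lipschitz K0 dtm_sqr_sub_le).
by apply/funext => u /=; rewrite fineK// dtm_sqr_fin_num.
Qed.

Lemma measurable_min_power k (mu : 'I_k -> probability (eucl R d) R) :
  measurable_fun [set: eucl R d] (min_power mu : eucl R d -> \bar R).
Proof.
have H (r : seq 'I_k) : measurable_fun [set: eucl R d] (fun x : eucl R d =>
    \big[mine/+oo%E]_(i <- r) (enorm ((x : 'rV[R]_d) - mean (mu i)) ^+ 2 + mean_sq_dev (mu i))%:E).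
  elim: r => [|i r IH].
    by rewrite (_ : (fun x => _) = cst +oo%E)//; apply/funext => x; rewrite big_nil.
  rewrite (_ : (fun x => _) = fun x : eucl R d => mine
     (enorm ((x : 'rV[R]_d) - mean (mu i)) ^+ 2 + mean_sq_dev (mu i))%:E
     (\big[mine/+oo%E]_(i <- r) (enorm ((x : 'rV[R]_d) - mean (mu i)) ^+ 2 + mean_sq_dev (mu i))%:E)).
    apply: measurable_mine => //; apply/measurable_EFinP; apply: measurable_funD => //.
    exact: measurable_sqr_dist.
  by apply/funext => x; rewrite big_cons.
exact: H.
Qed.

Lemma dtm_sqr_le_min_power k (mu : 'I_k -> probability (eucl R d) R) (u : 'rV[R]_d) :
  (forall i, submeasure P h (mu i)) -> (dtm P h u ^+ 2 <= min_power mu u)%E.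
Proof.
move=> Smu; rewrite /min_power; elim/big_ind: _; first by rewrite leey.
  by move=> x y xu yu; rewrite le_min xu.
move=> i _; rewrite -(bias_variance (submeasure_carried PK h0 (Smu i))).
exact: (dtm_sqr_le PK h0 h1 u (Smu i)).
Qed.

(** Both criteria are compared with the integral of d_{P,h}^2; it is finite, P being carried by a
    bounded set, and can therefore be cancelled. *)
Lemma integral_min_power_sub_dtm_le k (mu mu' : 'I_k -> probability (eucl R d) R) (C : R) :
  0 <= C -> (forall i, submeasure P h (mu i)) -> (forall i, submeasure P h (mu' i)) ->
  (forall u, min_power mu u < +oo)%E ->
  (criterion P mu <= criterion P mu')%E ->
  {ae P, forall u : eucl R d, (min_power mu' u <= dtm P h u ^+ 2 + C%:E)%E} ->
  (\int[P]_u (min_power mu u - dtm P h u ^+ 2) <= C%:E)%E.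
Proof.
move=> C0 Smu Smu' fmu opt HC.
have PT : P setT = 1%E by exact: probability_setT.
have mf := measurable_dtm_sqr.
have mg := measurable_min_power mu.
have mg' := measurable_min_power mu'.
have f0 (u : 'rV[R]_d) : (0 <= dtm P h u ^+ 2)%E by exact: sqre_ge0.
have fg (u : 'rV[R]_d) := dtm_sqr_le_min_power u Smu.
have fg' (u : 'rV[R]_d) := dtm_sqr_le_min_power u Smu'.
have ff := dtm_sqr_fin_num.
have mD : measurable_fun [set: eucl R d] (fun u : eucl R d => (min_power mu u - dtm P h u ^+ 2)%E).
  exact: emeasurable_funB.
have D0 (u : 'rV[R]_d) : (0 <= min_power mu u - dtm P h u ^+ 2)%E by rewrite sube_ge0// ff.
set If := (\int[P]_u (dtm P h u ^+ 2))%E.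
have If_fin : If \is a fin_num.
  rewrite ge0_fin_numE; last by apply: integral_ge0 => u _; exact: f0.
  apply: (@le_lt_trans _ _ (\int[P]_u (cst ((K + K) ^+ 2)%:E u))%E); last first.
    by rewrite integral_cst// [X in (_ * X)%E]PT mule1 ltry.
  apply: ae_ge0_le_integral => //.
  - by move=> u _; rewrite lee_fin sqr_ge0.
  - apply: filterS (ae_enorm_lt PK) => u uK _.
    have [m Lu] := exists_local_measure (u : 'rV[R]_d) PK h0 h1.
    have Su := local_measure_submeasure h0 Lu.
    apply: le_trans (dtm_sqr_le PK h0 h1 u Su) _.
    apply: le_trans (second_moment_le u Su) _.
    have K0' := ltW K0.
    by rewrite lee_fin lerXn2r ?nnegrE ?addr_ge0 ?enorm_ge0// lerD2l ltW.
have E : criterion P mu = (\int[P]_u (min_power mu u - dtm P h u ^+ 2) + If)%E.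
  rewrite /criterion -ge0_integralD//.
  by apply: eq_integral => u _; rewrite subeK// ff.
have E' : (criterion P mu' <= If + C%:E)%E.
  apply: (@le_trans _ _ (\int[P]_u (dtm P h u ^+ 2 + cst C%:E u))%E).
    apply: ae_ge0_le_integral => //.
    - by move=> u _; apply: le_trans (fg' u); exact: f0.
    - by move=> u _; rewrite adde_ge0.
    - exact: emeasurable_funD.
    - by apply: filterS HC => u uC _.
  by rewrite ge0_integralD// integral_cst// [X in (_ + _ * X)%E]PT mule1.
have := le_trans opt E'; rewrite E [leRHS]addeC leeD2rE//.
Qed.

End DtmContinuity.

Theorem corollary20 (R : realType) (d d' : nat) (N : set 'rV[R]_d) (c fmin : R) :
  (0 < d')%N ->
  C2_submanifold d' N -> compact N -> (0 < reach N)%E ->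
  0 < c -> 0 < fmin ->
  exists cN cN' : R, [/\ 0 < cN, 0 < cN' &
  forall fmax : R, exists2 C : R, 0 < C &
  forall (K : R) (P : probability (eucl R d) R) (f : 'rV[R]_d -> R),
    0 < K -> N `<=` eball 0 K%:E ->
    P (~` N) = 0%E ->
    has_density d' N P f ->
    (forall x, N x -> fmin <= f x <= fmax) ->
    (forall x r, N x -> 0 < r ->
       ((Num.min (c * fmin * r ^+ d') 1)%:E <= P (eball x r%:E))%E) ->
  forall (k : nat) (h : R) (dk : 'rV[R]_d -> R),
    cN <= k%:R -> 0 < h <= cN' ->
    is_kPDTM P h k dk ->
    (0 <= \int[P]_u ((dk u ^+ 2)%:E - dtm P h u ^+ 2)
       <= (C * k%:R `^ (- (2 / d'%:R)))%:E)%E].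
Proof.
move=> d'0 sN cN _ c0 fmin0.
have [r0 [Cv [r00 Cv0 Hmass]]] := mass_annulus sN cN.
set c1 := c * fmin; have c10 : 0 < c1 by rewrite mulr_gt0.
(* k >= 1 excludes the empty family; h <= 1 / 2 gives h < 1; the last bound on h keeps the annuli
   around net points within the radius [r0]. *)
exists 1, (Num.min 2^-1 (c1 * (r0 / 2) ^+ d')); split => //.
  by rewrite lt_min invr_gt0 ltr0n/= mulr_gt0// exprn_gt0// divr_gt0.
move=> fmax.
(* The absolute value because [fmax] is fixed before anything forces it to be nonnegative. *)
pose Q := 20 + 48 * (`|fmax| * Cv) * (3 / 2) ^+ d' / c1.
have Q0 : 0 < Q.
  by rewrite /Q ltr_pwDl// divr_ge0 ?(ltW c10)// !mulr_ge0 ?exprn_ge0 ?(ltW Cv0).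
(* This times k^(-2/d') is Q (2 y)^2, where 2 y is the mesh of the net. *)
exists (Q * 4 * c1 `^ (- (2 / d'%:R))).
  by rewrite mulr_gt0 ?powR_gt0// mulr_gt0.
move=> K P f K0 NK PN fd ff Hlow k h dk k1 /andP[h0].
rewrite le_min => /andP[h2 hr] [dk0 [s [mu [[Lmu opt] dkE]]]].
have h1 : h < 1 by lra.
have mN := measurable_compact cN.
have PT : P setT = 1%E by exact: probability_setT.
have PK : P (~` eball 0 K%:E) = 0%E.
  apply/eqP; rewrite eq_le measure_ge0 andbT -PN; apply: le_measure; rewrite ?inE.
  - by apply: measurableC; exact: measurable_eball.
  - exact: measurableC.
  - exact: subsetC.
have aeN : {ae P, forall u : eucl R d, N u}.
  by exists (~` N); split => //; exact: measurableC.
(* N cannot be empty, as its complement is null for a probability. *)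
have [x0 Nx0] : exists x, N x.
  apply: contrapT => no.
  have N0 : ~` N = setT.
    by apply/seteqP; split => // x _ Nx; apply: no; exists x.
  by move: PN; rewrite N0 PT => /eqP; rewrite onee_eq0.
have kR0 : 0 < k%:R :> R by lra.
have k0 : (0 < k)%N by rewrite -(ltr0n R).
have dne : d'%:R != 0 :> R by rewrite pnatr_eq0 -lt0n.
(* Solves c1 y^d' = 1 / k, so that balls of radius y about points of N have mass at least 1 / k. *)
pose y := (c1 * k%:R) `^ (- d'%:R^-1).
have y0 : 0 < y by rewrite powR_gt0// mulr_gt0.
have yd : c1 * y ^+ d' = k%:R^-1.
  rewrite -powR_mulrn ?(ltW y0)// /y -powRrM mulNr mulVf// powR_inv1; last first.
    by rewrite mulr_ge0// ltW.
  by field; rewrite !gt_eqF.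
have y2 : y ^+ 2 = c1 `^ (- (2 / d'%:R)) * k%:R `^ (- (2 / d'%:R)).
  rewrite -powRM ?(ltW c10) ?(ltW kR0)// -powR_mulrn ?(ltW y0)// /y -powRrM.
  by congr (_ `^ _); rewrite mulNr mulrC.
have net (x : 'rV[R]_d) : N x -> (k%:R^-1%:E <= P (eball x ((2 * y) / 2)%:E))%E.
  move=> Nx; rewrite mulrAC divff// mul1r.
  apply: le_trans (Hlow x y Nx y0); rewrite lee_fin le_min -/c1 yd lexx/=.
  by rewrite invf_le1.
have [t [Nt tnet]] := finite_net Nx0 k0 net.
have [mu' Lmu'] : exists mu' : 'I_k -> probability (eucl R d) R,
    forall i, local_measure P h (FinitePoint (t i)) (mu' i).
  have /choice[mu' ?] : forall i, exists m, local_measure P h (FinitePoint (t i)) m.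
    by move=> i; exact: (exists_local_measure (t i) PK h0 h1).
  by exists mu'.
have Smu i : submeasure P h (mu i) by exact: local_measure_submeasure h0 (Lmu i).
have Smu' i : submeasure P h (mu' i) by exact: local_measure_submeasure h0 (Lmu' i).
have quad u i : N u -> (second_moment (mu' i) u <= dtm P h u ^+ 2 +
     (Q * enorm (u - t i) ^+ 2)%:E)%E.
  move=> Nu.
  have [muu Lu] := exists_local_measure u PK h0 h1.
  have dr : delta P h (t i) = (fine (delta P h (t i)))%:E.
    by rewrite fineK// (delta_fin_num _ PK).
  have rge0 : 0 <= fine (delta P h (t i)) by rewrite fine_ge0// delta_ge0.
  have cr := delta_pow_le h0 h1 d'0 c10 dr (fun s => Hlow (t i) s (Nt i)).
  (* c1 delta^d' <= h <= c1 (r0 / 2)^d', and d'-th powers compare. *)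
  have rr0 : 2 * fine (delta P h (t i)) <= r0.
    rewrite mulrC -ler_pdivlMr// -(@ler_pXn2r _ d')// ?nnegrE ?divr_ge0 ?(ltW r00)//.
    by rewrite -(ler_pM2l c10) (le_trans cr).
  apply: (second_moment_quadratic PK h0 h1 (Lmu' i) Lu dr c10 _ cr rr0).
    by rewrite mulr_ge0// ltW.
  move=> a b a0 ab br0.
  apply: (Hmass P f `|fmax| fd _ (t i) a b (Nt i) a0 ab br0) => x /ff/andP[f1 f2].
  by rewrite (le_trans (ltW fmin0) f1) (le_trans f2)// ler_norm.
have eE : (fun u : eucl R d => ((dk u ^+ 2)%:E - dtm P h u ^+ 2)%E) =
    (fun u : eucl R d => (min_power mu u - dtm P h u ^+ 2)%E).
  by apply/funext => u; rewrite dkE.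
rewrite eE; apply/andP; split.
  apply: integral_ge0 => u _.
  by rewrite sube_ge0 ?(dtm_sqr_fin_num PK h0 h1)// (dtm_sqr_le_min_power PK h0 h1).
have -> : Q * 4 * c1 `^ (- (2 / d'%:R)) * k%:R `^ (- (2 / d'%:R)) = Q * (2 * y) ^+ 2.
  by rewrite exprMn y2; ring.
apply: (integral_min_power_sub_dtm_le PK h0 h1 K0 _ Smu Smu').
- by rewrite mulr_ge0 ?sqr_ge0// ltW.
- by move=> u; rewrite -dkE ltry.
- exact: opt Lmu'.
- suff H : forall u : eucl R d, N u -> (min_power mu' u <= dtm P h u ^+ 2 + (Q * (2 * y) ^+ 2)%:E)%E.
    by apply: filterS H aeN.
  move=> u Nu; have [i ui] := tnet u Nu.
  apply: (@le_trans _ _ (second_moment (mu' i) u)).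
    rewrite (bias_variance (submeasure_carried PK h0 (Smu' i))).
    exact: bigmin_le.
  apply: le_trans (quad u i Nu) _.
  rewrite leeD2l// lee_fin ler_wpM2l ?(ltW Q0)//.
  by rewrite lerXn2r ?nnegrE ?enorm_ge0 ?mulr_ge0 ?(ltW y0)// ltW.
Qed.
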